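(* Let $1\le k<m$ be integers. Let $E\subset A(m,k)$ be a non-empty collection of non-vertical affine subspaces such that $B=\bigcup_{P\in E}P\subset\mathbb{R}^m$ is Borel, and let $\beta=\mathrm{ess}^{k}\text{-}\sup(\dim B_t)$. Then for each $P\in E$ there exists $P'\subset P$ with $\mathcal{H}^k(P\setminus P')=0$ such that for $B'=\bigcup_{P\in E}P'\subset B$ we have $\dim B'=\beta+k$.
   Context: $\dim$ denotes Hausdorff dimension and $\mathcal{H}^k$ the $k$-dimensional Hausdorff measure. $A(m,k)$ is the space of all $k$-dimensional affine subspaces of $\mathbb{R}^m$. Write $\mathbb{R}^m=\mathbb{R}^k\times\mathbb{R}^{m-k}$; $P\in A(m,k)$ is non-vertical if its orthogonal projection to $\mathbb{R}^k\times\{0\}$ is all of $\mathbb{R}^k\times\{0\}$. For $t\in\mathbb{R}^k$, $B_t=\{x\in\mathbb{R}^{m-k}:(t,x)\in B\}$, and (since $\mathrm{proj}_{\mathbb{R}^k}B=\mathbb{R}^k$ here) $\mathrm{ess}^{k}\text{-}\sup(\dim B_t)=\sup\{q\ge0:\mathcal{H}^k(\{t\in\mathbb{R}^k:\dim B_t>q\})>0\}$, with $\sup\emptyset=0$. *)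

(* Defs.v *)
From HB Require Import structures.
From mathcomp Require Export all_boot all_order all_algebra.
From mathcomp Require Export all_classical all_reals all_analysis.

Set Implicit Arguments.
Unset Strict Implicit.
Unset Printing Implicit Defensive.

Import Order.TTheory GRing.Theory Num.Theory.
Import numFieldNormedType.Exports.

Local Open Scope classical_set_scope.
Local Open Scope ring_scope.

(* The library norm `|x| on 'rV[R]_m is the sup norm; diameters are taken for
   the Euclidean distance. Both induce the same topology. *)
Definition euclid_dist (R : realType) (m : nat) (x y : 'rV[R]_m) : R :=
  Num.sqrt (\sum_(i < m) (x 0 i - y 0 i) ^+ 2).

(* -oo on the empty set, +oo on unbounded sets. *)
Definition diam (R : realType) (m : nat) (U : set 'rV[R]_m) : \bar R :=
  ereal_sup [set z | exists x y, [/\ U x, U y & z = (euclid_dist x y)%:E]].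

(* diam(U)^s with 0^0 = 1 for nonempty U, so that H^0 is the counting measure,
   and the empty set contributes 0 for every s. *)
Definition diam_pow (R : realType) (m : nat) (s : R) (U : set 'rV[R]_m) :
    \bar R :=
  if U == set0 then 0%E else poweR (diam U) s.

Definition hausdorff_pre (R : realType) (m : nat) (s delta : R)
    (A : set 'rV[R]_m) : \bar R :=
  ereal_inf [set v | exists U : nat -> set 'rV[R]_m,
    [/\ A `<=` \bigcup_i U i,
        forall i, (diam (U i) <= delta%:E)%E &
        v = (\sum_(0 <= i <oo) diam_pow s (U i))%E]].

(* The s-dimensional Hausdorff (outer) measure, without a normalizing
   constant. *)
Definition hausdorff_measure (R : realType) (m : nat) (s : R)
    (A : set 'rV[R]_m) : \bar R :=
  ereal_sup [set hausdorff_pre s delta A | delta in [set d : R | 0 < d]].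

Definition hausdorff_dim (R : realType) (m : nat) (A : set 'rV[R]_m) :
    \bar R :=
  ereal_inf [set s%:E | s in [set s : R | 0 <= s /\
                                          hausdorff_measure s A = 0%E]].

Definition affine_grassmannian (R : realType) (m k : nat) :
    set (set 'rV[R]_m) :=
  [set P | exists (a : 'rV[R]_m) (V : {vspace 'rV[R]_m}),
     \dim V = k /\ P = [set x | x - a \in V]].
Arguments affine_grassmannian R m k : clear implicits.

(* R^m with m = k + n is 'rV[R]_(k + n), and (t, x) is row_mx t x. *)
Definition proj_horizontal (R : realType) (k n : nat) (x : 'rV[R]_(k + n)) :
    'rV[R]_(k + n) :=
  row_mx (lsubmx x) 0.

Definition nonvertical (R : realType) (k n : nat) (P : set 'rV[R]_(k + n)) :
    Prop :=
  [set proj_horizontal x | x in P] = [set row_mx t 0 | t in [set: 'rV[R]_k]].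

Definition slice (R : realType) (k n : nat) (B : set 'rV[R]_(k + n))
    (t : 'rV[R]_k) : set 'rV[R]_n :=
  [set x | B (row_mx t x)].

Definition borel_set (R : realType) (m : nat) (B : set 'rV[R]_m) : Prop :=
  <<s [set U : set 'rV[R]_m | open U] >> B.

(* Adjoining 0 to the set of admissible q >= 0 only serves to make the supremum
   of the empty set 0. *)
Definition ess_sup_slice_dim (R : realType) (k n : nat)
    (B : set 'rV[R]_(k + n)) : \bar R :=
  ereal_sup (0%E |` [set q%:E | q in [set q : R | 0 <= q /\
    (0 < hausdorff_measure k%:R
           [set t : 'rV[R]_k | (q%:E < hausdorff_dim (slice B t))%E])%E]]).

(* Main.v *)
(* Proof idea.  Everything is done with dyadic cubes and the outer measure [lam]
   on R^k generated by their volumes.  Let B be the union of the planes and let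
   s exceed the essential supremum beta.

   Almost every slice B_t is H^s-null, so it has covers by dyadic cubes Q with
   arbitrarily small sum of diam(Q)^s.  Such covers can be chosen measurably in t:
   the least cost [cap] of a measurable family of covers is continuous along
   increasing sequences, hence Borel sets are capacitable for it, and for a compact
   set the tube lemma provides measurable families.  If T_Q denotes the set of t
   whose cover uses Q, let L consist of the (t, x) such that, for infinitely many
   levels j, T_Q has density at least 2^(-eps j) in the cube I of t, where Q is the
   cube of x of the same level as I.  Counting the cubes I * Q gives
   dim L <= k + s + 2 eps.  On a Lipschitz graph over R^k only boundedly many Q lie
   over a given I, so by Borel-Cantelli almost all of a plane contained in B lies
   in L.  Intersecting over s -> beta yields B' with dim B' <= k + beta.

   For the lower bound, B has compact subsets with positive [cap] for every
   exponent q < beta, hence of positive H^(k+q)-measure; by Besicovitch they have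
   subsets of dimension exactly k + q, which may be added to B'. *)

Require Import Defs.
From HB Require Import structures.
From mathcomp Require Import all_boot all_order all_algebra.
From mathcomp Require Import all_classical all_reals all_analysis.
From mathcomp Require Import measurable_realfun.
From mathcomp Require Import ring lra zify.
Import Order.TTheory GRing.Theory Num.Theory.
Import numFieldNormedType.Exports.

Set Implicit Arguments.
Unset Strict Implicit.
Unset Printing Implicit Defensive.

Local Open Scope classical_set_scope.
Local Open Scope ring_scope.

(** * Unordered sums *)

Section Esum.
Context {R : realType}.
Local Open Scope ereal_scope.

(** The family [E] is arbitrary, uncountable and without measurable structure, so null sets cannot
    be discarded plane by plane: one set, independent of the plane, has to work for all of them, and
    [P'] is [P] intersected with it. Null slices alone do not bound the dimension of B: over a null
    set of t the slices may be as large as they like, and the base pieces T_Q may be much finer than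
    Q, so that the products of small [cap] are thin slabs rather than cubes. Density at the scale of
    Q singles out the places where the slabs fill a genuine cube up to the factor 2^(-eps j). Of the
    two eps lost, one pays for that factor, the other makes the tails of the covers small. Dimension
    depends on null sets only, and dyadic contents without mesh condition have the same null sets as
    Hausdorff measures of positive exponent; hence constants never matter, and measurability of t ->
    dim B_t does not come up. The compact sets of the lower bound may themselves have dimension
    above k + beta, which is why they are thinned out before being added. *)

Lemma esum_subset (I : choiceType) (A B : set I) (a : I -> \bar R) :
  A `<=` B -> (forall i, 0 <= a i) -> \esum_(i in A) a i <= \esum_(i in B) a i.
Proof.
move=> AB a0; rewrite esum_mkcond [leRHS]esum_mkcond; apply: le_esum => i _.
case: ifPn => [/set_mem /AB iB|_]; first by rewrite mem_set.
by case: ifP.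
Qed.

(** Choosing one preimage of each element of [B] makes [A] majorise [B]. This compares the weights
    of two covers when several sets of one correspond to the same set of the other. *)
Lemma esum_le_cover (I J : choiceType) (A : set I) (B : set J) (e : I -> J)
    (a : J -> \bar R) (b : I -> \bar R) :
  (forall i, 0 <= b i) ->
  (forall j, B j -> exists2 i, A i & e i = j) ->
  (forall i, A i -> a (e i) <= b i) ->
  \esum_(j in B) a j <= \esum_(i in A) b i.
Proof.
move=> b0 surj ab.
have [[i0 _]|noI] := pselect (exists i : I, True); last first.
  rewrite esum1; first exact: esum_ge0.
  by move=> j /surj[i]; exfalso; apply: noI; exists i.
pose g j := if pselect (exists2 i, A i & e i = j) is left p
  then projT1 (cid2 p) else i0.
have gP j : B j -> A (g j) /\ e (g j) = j.
  move=> /surj p; rewrite /g; case: pselect => // p'.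
  by case: (cid2 p').
have ginj : set_inj B g.
  move=> x y /set_mem Bx /set_mem By gxy.
  by rewrite -(gP x Bx).2 -(gP y By).2 gxy.
apply: (@le_trans _ _ (\esum_(j in B) b (g j))).
  by apply: le_esum => j Bj; have [Ag {1}<-] := gP j Bj; apply: ab.
rewrite -(esum_image B g b) //; apply: esum_subset => // _ [j Bj <-].
by have [] := gP j Bj.
Qed.

Lemma esum_cmul (I : choiceType) (A : set I) (a : I -> \bar R) (c : R) :
  (0 <= c)%R -> (forall i, 0 <= a i) ->
  \esum_(i in A) (c%:E * a i) = c%:E * \esum_(i in A) a i.
Proof.
have le (b : I -> \bar R) (d : R) : (0 <= d)%R -> (forall i, 0 <= b i) ->
    \esum_(i in A) (d%:E * b i) <= d%:E * \esum_(i in A) b i.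
  move=> d0 b0; apply: ge_ereal_sup => _ [X [finX XA]] <-.
  rewrite fsbig_finite//= -ge0_sume_distrr; last by [].
  apply: lee_wpmul2l; first by rewrite lee_fin.
  by apply: ereal_sup_ubound; exists X => //; rewrite fsbig_finite.
move=> c0 a0; apply/eqP; rewrite eq_le le//=.
have [->|cn0] := eqVneq c 0%R.
  by rewrite mul0e esum_ge0// => i _; rewrite mul0e.
have c1 : (0 < c)%R by rewrite lt_def cn0.
rewrite -lee_pdivlMl//.
apply: le_trans (le (fun i => c%:E * a i) _ _ _); last 2 first.
- by rewrite invr_ge0.
- by move=> i; rewrite mule_ge0// lee_fin.
by apply: le_esum => i _; rewrite muleA -EFinM mulVf// mul1e.
Qed.

Lemma esum_swap (I J : choiceType) (A : set I) (B : set J)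
    (a : I -> J -> \bar R) :
  (forall i j, 0 <= a i j) ->
  \esum_(i in A) \esum_(j in B) a i j = \esum_(j in B) \esum_(i in A) a i j.
Proof.
move=> a0; rewrite !esum_esum //.
rewrite (reindex_esum (B `*`` fun=> A) _ (fun x => (x.2, x.1)))//; split=> //=.
- by move=> [i j] [/=].
- by move=> [i1 i2] [j1 j2] /= _ _ [] -> ->.
- by move=> [i1 i2] [Pi1 Qi2] /=; exists (i2, i1).
Qed.

Lemma esum_finT (T : finType) (a : T -> \bar R) : (forall i, 0 <= a i) ->
  \esum_(i in [set: T]) a i = \sum_(i : T) a i.
Proof.
move=> a0; have fT : finite_set [set: T] by exact: finite_finset.
rewrite esum_fset// fsbig_finite//= -[RHS]big_enum /=.
apply: perm_big; apply: uniq_perm; rewrite ?finmap.fset_uniq ?enum_uniq// => i.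
by rewrite in_fset_set// mem_enum in_setT.
Qed.

Lemma esum_fin (T : finType) (A : set T) (a : T -> \bar R) (c : R) :
  (0 <= c)%R -> (forall i, 0 <= a i) -> (forall i, a i <= c%:E) ->
  \esum_(i in A) a i <= (#|T|%:R * c)%:E.
Proof.
move=> c0 a0 ac; apply: (@le_trans _ _ (\esum_(i in [set: T]) a i)).
  exact: esum_subset.
rewrite esum_finT//; apply: (@le_trans _ _ (\sum_(i : T) c%:E)).
  by apply: lee_sum.
have <- : #|xpredT : pred T| = #|T| by apply: eq_card.
by rewrite sumEFin sumr_const mulr_natl.
Qed.

Lemma esum_eps (I : countType) (A : set I) (e : R) :
  (0 <= e)%R -> \esum_(i in A) (e / 2 ^+ (pickle i).+1)%:E <= e%:E.
Proof.
move=> e0.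
apply: (@le_trans _ _ (\esum_(i in [set: nat]) (e / 2 ^+ i.+1)%:E)).
  rewrite -(esum_image A pickle (fun i => (e / 2 ^+ i.+1)%:E)).
    by apply: esum_subset => // i; rewrite lee_fin divr_ge0// exprn_ge0.
  move=> x y _ _; exact: (pcan_inj (@pickleK _)).
rewrite -nneseries_esumT; last by move=> i; rewrite lee_fin divr_ge0// exprn_ge0.
have := @epsilon_trick0 R e xpredT e0.
by under eq_eseriesr do rewrite natrX.
Qed.

(** The bookkeeping for replacing every set of a cover by its children or its neighbours: [F]
    indexes the replacements and [w] bounds the weight of each. *)
Lemma esum_fibers (I J : choiceType) (F : finType) (U : set I) (g : I * F -> J)
    (v : J -> R) (w : I -> R) :
  (forall i, 0 <= w i)%R -> (forall i f, v (g (i, f)) <= w i)%R ->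
  \esum_(j in g @` (U `*` setT)) (v j)%:E <=
  (#|F|%:R)%:E * \esum_(i in U) (w i)%:E.
Proof.
move=> w0 vw; rewrite -esum_cmul//.
apply: (@le_trans _ _ (\esum_(p in U `*`` fun=> setT) (w p.1)%:E)).
  apply: (esum_le_cover (e := g)) => // [p|[i f] _]; first by rewrite lee_fin.
  by rewrite lee_fin vw.
rewrite -(esum_esum (a := fun i (f : F) => (w i)%:E)); last first.
  by move=> *; rewrite lee_fin.
by apply: le_esum => i _; rewrite -EFinM; apply: esum_fin => // *; rewrite lee_fin.
Qed.

Lemma nneseries_pickle (I : countType) (f : I -> \bar R) : (forall i, 0 <= f i) ->
  \sum_(0 <= l <oo) (if pickle_inv l is Some i then f i else 0) =
  \esum_(i in setT) f i.
Proof.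
move=> f0; rewrite nneseries_esumT; last by move=> l; case: pickle_inv.
have inj : set_inj setT (fun i : I => pickle i).
  by move=> i j _ _; exact: (pcan_inj (@pickleK _)).
pose F (l : nat) : \bar R := if pickle_inv l is Some i then f (i : I) else 0.
have -> : \esum_(i in setT) f i = \esum_(i in [set: I]) F (pickle i).
  by apply: eq_esum => i _; rewrite /F pickleK_inv.
rewrite -(esum_image setT (fun i : I => pickle i) F)// [RHS]esum_mkcond.
apply: eq_esum => l _; case: ifPn => // /negP nl; rewrite -/(F l) /F.
case E : (pickle_inv l) => [i|//]; exfalso; apply: nl; apply/mem_set.
by exists i => //; have := @pickle_invK I l; rewrite E.
Qed.

End Esum.

(** * Contents given by countable covers *)

Section CoverContent.
Context {R : realType} {T : Type} {I : choiceType}.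
Variables (D : set I) (q : I -> set T) (w : I -> R).
Hypothesis w0 : forall i, 0 <= w i.
Local Open Scope ereal_scope.

Definition covers (U : set I) (A : set T) :=
  forall x, A x -> exists2 i, U i & q i x.

(** The common form of [dcont], [cap] and [ccont]; the restriction to [D] serves [ccont], where it
    imposes a minimal word length. *)
Definition content (A : set T) : \bar R :=
  ereal_inf [set \esum_(i in U) (w i)%:E | U in [set U | U `<=` D /\ covers U A]].

Lemma content_le U A : U `<=` D -> covers U A -> content A <= \esum_(i in U) (w i)%:E.
Proof. by move=> UD UA; apply: ereal_inf_lbound; exists U. Qed.

Let w0E i : 0 <= (w i)%:E. Proof. by rewrite lee_fin. Qed.

Lemma content_ge0 A : 0 <= content A.
Proof. by apply: le_ereal_inf_tmp => _ [U _ <-]; apply: esum_ge0. Qed.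

Lemma content_lt A e : content A < e ->
  exists U, [/\ U `<=` D, covers U A & \esum_(i in U) (w i)%:E < e].
Proof. by move=> /ereal_inf_lt[_ [U [UD UA] <-] Ue]; exists U. Qed.

Lemma content_subset A B : A `<=` B -> content A <= content B.
Proof.
move=> AB; apply: ereal_inf_le_tmp => _ [U [UD UB] <-]; exists U => //.
by split=> // x /AB/UB.
Qed.

Lemma content_set0 : content set0 = 0.
Proof.
apply/eqP; rewrite eq_le content_ge0 andbT -(esum_set0 (fun i => (w i)%:E)).
by apply: content_le.
Qed.

Lemma content1 i A : D i -> A `<=` q i -> content A <= (w i)%:E.
Proof.
move=> Di Ai; rewrite -(@esum_set1 _ _ i (fun i => (w i)%:E))//.
by apply: content_le => [_ ->//|x /Ai]; exists i.
Qed.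

Lemma content_bigcup (J : countType) (K : set J) (A : J -> set T) :
  content (\bigcup_(j in K) A j) <= \esum_(j in K) content (A j).
Proof.
have [[j [Kj Aoo]]|fin] := pselect (exists j, K j /\ content (A j) = +oo).
  have -> : \esum_(j in K) content (A j) = +oo; last exact: leey.
  apply/eqP; rewrite -leye_eq.
  rewrite -Aoo -(@esum_set1 _ _ j (fun j => content (A j)))//; last first.
    exact: content_ge0.
  by apply: esum_subset => [_ ->//|i]; exact: content_ge0.
apply/lee_addgt0Pr => e e0.
have /choice[U HU] : forall j, exists U, K j -> [/\ U `<=` D, covers U (A j) &
    \esum_(i in U) (w i)%:E <= content (A j) + (e / 2 ^+ (pickle j).+1)%:E].
  move=> j; have [Kj|] := pselect (K j); last by exists set0.
  have fj : content (A j) \is a fin_num.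
    rewrite ge0_fin_numE ?content_ge0// ltey; apply/eqP => Aoo.
    by apply: fin; exists j.
  have /content_lt[U [UD UA Ue]] : content (A j) <
      content (A j) + (e / 2 ^+ (pickle j).+1)%:E.
    by rewrite lteDl// lte_fin divr_gt0// exprn_gt0.
  by exists U => _; split=> //; exact: ltW.
apply: (@le_trans _ _ (\esum_(i in \bigcup_(j in K) U j) (w i)%:E)).
  apply: content_le => [i [j Kj]|x [j Kj]].
    by have [+ _ _] := HU j Kj; apply.
  by have [_ + _] := HU j Kj => /[apply] -[i Ui qix]; exists i => //; exists j.
apply: (@le_trans _ _ (\esum_(k in K `*`` U) (w k.2)%:E)).
  apply: (esum_le_cover (e := snd)) => // i [j Kj Uji]; by exists (j, i).
rewrite -(esum_esum (a := fun j i => (w i)%:E))//.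
apply: (@le_trans _ _ (\esum_(j in K) (content (A j) +
   (e / 2 ^+ (pickle j).+1)%:E))).
  by apply: le_esum => j Kj; have [] := HU j Kj.
rewrite esumD; [|by move=> *; exact: content_ge0|].
  by rewrite leeD2l// esum_eps// ltW.
by move=> j _; rewrite lee_fin divr_ge0 ?exprn_ge0// ltW.
Qed.

Lemma content_bigcup0 (J : countType) (K : set J) (A : J -> set T) :
  (forall j, K j -> content (A j) = 0) -> content (\bigcup_(j in K) A j) = 0.
Proof.
move=> A0; apply/eqP; rewrite eq_le content_ge0 andbT.
by apply: (le_trans (content_bigcup _ _)); rewrite esum1.
Qed.

Lemma content_setU A B : content (A `|` B) <= content A + content B.
Proof.
have := content_bigcup setT (fun b : bool => if b then A else B).
have -> : \bigcup_(b in [set: bool]) (if b then A else B) = A `|` B.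
  apply/seteqP; split=> [x [[] _ ?]|x [?|?]]; [by left|by right| |];
  by [exists true|exists false].
move=> /le_trans; apply.
rewrite (_ : [set: bool] = [set true; false]); last first.
  by apply/seteqP; split=> // -[]; [left|right].
rewrite (esumID [set true]) ?setIUl; last by move=> *; exact: content_ge0.
have -> : [set true] `&` [set true] `|` [set false] `&` [set true] = [set true].
  by apply/seteqP; split=> [x [[]//|[-> //]]|x ->]; left.
have -> : [set true] `&` ~` [set true] `|` [set false] `&` ~` [set true]
   = [set false].
  by apply/seteqP; split=> [x [[]//|[-> //]]|x ->]; right.
by rewrite !esum_set1//; exact: content_ge0.
Qed.

Lemma content_sigma_subadditive : sigma_subadditive content.
Proof.
move=> F; rewrite nneseries_esumT; last by move=> i; exact: content_ge0.
exact: content_bigcup.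
Qed.

Lemma content_eq0 A : content A = 0 <-> forall e : R, (0 < e)%R ->
  exists U, [/\ U `<=` D, covers U A & \esum_(i in U) (w i)%:E <= e%:E].
Proof.
split=> [A0 e e0|H].
  have /content_lt[U [? ? ?]] : content A < e%:E by rewrite A0 lte_fin.
  by exists U; split=> //; exact: ltW.
apply/eqP; rewrite eq_le content_ge0 andbT; apply/lee_addgt0Pr => e /H[U [UD UA Ue]].
by rewrite add0e; apply: le_trans Ue; exact: content_le.
Qed.

Lemma content_null_subset A B : A `<=` B -> content B = 0 -> content A = 0.
Proof.
move=> AB B0; apply/eqP; rewrite eq_le content_ge0 andbT -B0.
exact: content_subset.
Qed.

Lemma content_nullU A B : content A = 0 -> content B = 0 -> content (A `|` B) = 0.
Proof.
move=> A0 B0; apply/eqP; rewrite eq_le content_ge0 andbT.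
by apply: (le_trans (content_setU _ _)); rewrite A0 B0 adde0.
Qed.

End CoverContent.

(** * Dyadic cubes *)

Section Weights.
Context {R : realType}.
Implicit Types (s t e : R) (j : nat).

(* [(2 ^- j) ^ s] *)
Definition pw s j : R := (2 `^ (- s)) ^+ j.

Lemma pw_gt0 s j : 0 < pw s j.
Proof. by rewrite exprn_gt0// powR_gt0. Qed.

Lemma pw_ge0 s j : 0 <= pw s j. Proof. exact/ltW/pw_gt0. Qed.

Lemma pwD s t j : pw (s + t) j = pw s j * pw t j.
Proof. by rewrite /pw opprD powRD ?pnatr_eq0 ?implybT// exprMn. Qed.

Lemma pwDn s j i : pw s (j + i) = pw s j * pw s i.
Proof. exact: exprD. Qed.

Lemma pw_nat k j : pw k%:R j = ((2 ^+ j) ^+ k)^-1.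
Proof. by rewrite /pw powRN powR_mulrn// exprVn -!exprM mulnC. Qed.

Lemma pw0 s : pw s 0 = 1. Proof. exact: expr0. Qed.

Let base_le1 s : 0 <= s -> 2 `^ (- s) <= 1.
Proof.
move=> s0; rewrite powRN invf_le1 ?powR_gt0//.
by rewrite -[leLHS](powRr0 2) ler_powR// ler1n.
Qed.

Let base_lt1 s : 0 < s -> 2 `^ (- s) < 1.
Proof.
move=> s0; rewrite powRN invf_lt1 ?powR_gt0//.
rewrite lt_neqAle -[leLHS](powRr0 2) ler_powR ?ler1n ?(ltW s0)// andbT.
by rewrite eq_sym powR_eq1 gt_eqF// ?ltr1n//= gt_eqF// ltNge ler0n.
Qed.

Lemma pw_le1 s j : 0 <= s -> pw s j <= 1.
Proof. by move=> s0; rewrite exprn_ile1// ?base_le1// powR_ge0. Qed.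

Lemma pw_anti s j i : 0 <= s -> (j <= i)%N -> pw s i <= pw s j.
Proof. by move=> s0 ji; rewrite ler_wiXn2l// ?base_le1// powR_ge0. Qed.

Lemma pw_antis s t j : s <= t -> pw t j <= pw s j.
Proof.
move=> st; rewrite -(subrK s t) addrC pwD -[leRHS]mulr1 ler_wpM2l ?pw_ge0//.
by rewrite pw_le1// subr_ge0.
Qed.

Lemma pw_ltn s j i : 0 < s -> pw s i < pw s j -> (j < i)%N.
Proof.
move=> s0; rewrite ltnNge; apply: contraTN => ij.
by rewrite -leNgt pw_anti// ltW.
Qed.

(** Small total weight forces every set of a cover to be fine; for [0 < s] this stands in for mesh
    conditions. *)
Lemma pw_leq s j i : 0 < s -> pw s i <= pw s j -> (j <= i)%N.
Proof.
move=> s0; rewrite leqNgt; apply: contraTN => ij.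
by rewrite -ltNge ltr_iXn2l// ?base_lt1// powR_gt0.
Qed.

Lemma pw_small s e : 0 < s -> 0 < e -> exists j, pw s j < e.
Proof.
move=> s0 e0; have g1 := base_lt1 s0.
have : (fun j => pw s j) @ \oo --> (0 : R).
  by apply: cvg_expr; rewrite ger0_norm// powR_ge0.
move=> /cvgrPdist_lt /(_ e e0) [N _ HN]; exists N.
by have := HN N (leqnn N); rewrite /= sub0r normrN gtr0_norm// pw_gt0.
Qed.

End Weights.

Section Cubes.
Context {R : realType}.
Implicit Types (m : nat).

Definition cubeidx m := (nat * 'rV[int]_m)%type.

(** Floors give half-open cubes, which partition the space at each level, so that any two cubes are
    nested or disjoint. *)
Definition fidx m j (x : 'rV[R]_m) : 'rV[int]_m :=
  \row_i Num.floor (2 ^+ j * x 0 i).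

Definition cube m (c : cubeidx m) : set 'rV[R]_m := [set x | fidx c.1 x = c.2].

Definition subidx m (z : 'rV[int]_m) i (e : {ffun 'I_m -> 'I_(2 ^ i)}) :
  'rV[int]_m := \row_a (z 0 a * (2 ^ i)%N%:Z + (e a : nat)%:Z).

Lemma floor_mul2n i (y : R) : (Num.floor (2 ^+ i * y) %/ (2 ^ i)%N)%Z = Num.floor y.
Proof.
have d0 : (0 < (2 ^ i)%N%:Z) by rewrite ltz_nat expn_gt0.
have /andP[f1 f2] := floor_itv y.
set F := Num.floor (2 ^+ i * y); set f := Num.floor y in f1 f2 *.
have r0 : 0 < 2 ^+ i :> R by rewrite exprn_gt0.
have E : ((2 ^ i)%N%:Z)%:~R = 2 ^+ i :> R by rewrite -pmulrn natrX.
have F1 : f * (2 ^ i)%N%:Z <= F.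
  by rewrite floor_ge_int intrM E mulrC ler_pM2l.
have F2 : F < (f + 1) * (2 ^ i)%N%:Z.
  rewrite -(ltr_int R); apply: (le_lt_trans (floor_le _)).
  by rewrite intrM E mulrC ltr_pM2r.
apply/eqP; rewrite eq_le -ltzD1 ltz_divLR// F2 /=.
by rewrite lez_divRL.
Qed.

Lemma fidx_div m j i (x : 'rV[R]_m) a :
  fidx j x 0 a = (fidx (j + i) x 0%R a %/ (2 ^ i)%N)%Z.
Proof. by rewrite !mxE addnC exprD -mulrA floor_mul2n. Qed.

Lemma fidx_coarser m j i (x y : 'rV[R]_m) : (j <= i)%N ->
  fidx i x = fidx i y -> fidx j x = fidx j y.
Proof.
move=> ji E; apply/rowP => a.
by rewrite !(fidx_div j (i - j)) subnKC// E.
Qed.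

Lemma fidx_subidx m j i (x : 'rV[R]_m) :
  exists e, fidx (j + i) x = subidx (fidx j x) (i := i) e.
Proof.
have d0 : (0 < (2 ^ i)%N%:Z) by rewrite ltz_nat expn_gt0.
have lt a : (absz (modz (fidx (j + i) x 0%R a) (2 ^ i)%N) < 2 ^ i)%N.
  by rewrite -ltz_nat gez0_abs ?modz_ge0 ?ltz_pmod// gt_eqF.
exists [ffun a => Ordinal (lt a)]; apply/rowP => a.
rewrite [RHS]mxE ffunE /= (fidx_div j i) gez0_abs ?modz_ge0 ?gt_eqF//.
exact: divz_eq.
Qed.

Lemma cube_nested m (c d : cubeidx m) x : (c.1 <= d.1)%N ->
  cube c x -> cube d x -> cube d `<=` cube c.
Proof.
move=> cd cx dx y dy; rewrite /cube/= in cx dx dy *; rewrite -cx.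
by apply: fidx_coarser cd _; rewrite dy.
Qed.

(** A Hausdorff content rather than a measure: cubes of all levels are allowed. For [0 < s] its null
    sets are those of [hausdorff_measure s]. *)
Definition dcont m (s : R) : set 'rV[R]_m -> \bar R :=
  content setT (@cube m) (fun c => pw s c.1).

Lemma dcont_bigcup m s (J : countType) (K : set J) (A : J -> set 'rV[R]_m) :
  (dcont s (\bigcup_(j in K) A j) <= \esum_(j in K) dcont s (A j))%E.
Proof. by apply: content_bigcup => c; exact: pw_ge0. Qed.

Lemma dcont_ge0 m s (A : set 'rV[R]_m) : (0 <= dcont s A)%E.
Proof. by apply: content_ge0 => c; exact: pw_ge0. Qed.

Lemma dcont_subset m s (A B : set 'rV[R]_m) : A `<=` B -> (dcont s A <= dcont s B)%E.
Proof. exact: content_subset. Qed.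

Lemma dcont_null_subset m s (A B : set 'rV[R]_m) :
  A `<=` B -> dcont s B = 0%E -> dcont s A = 0%E.
Proof. by apply: content_null_subset => c; exact: pw_ge0. Qed.

Lemma dcont_bigcup0 m s (J : countType) (K : set J) (A : J -> set 'rV[R]_m) :
  (forall j, K j -> dcont s (A j) = 0%E) -> dcont s (\bigcup_(j in K) A j) = 0%E.
Proof. by apply: content_bigcup0 => c; exact: pw_ge0. Qed.

Lemma dcont_nullU m s (A B : set 'rV[R]_m) :
  dcont s A = 0%E -> dcont s B = 0%E -> dcont s (A `|` B) = 0%E.
Proof. by apply: content_nullU => c; exact: pw_ge0. Qed.

Lemma dcont_cube m s (c : cubeidx m) : (dcont s (cube c) <= (pw s c.1)%:E)%E.
Proof. by apply: content1 => // i; exact: pw_ge0. Qed.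

Lemma dcont_eq0 m s (A : set 'rV[R]_m) : dcont s A = 0%E <->
  forall e : R, 0 < e -> exists U : set (cubeidx m), covers (@cube m) U A /\
    (\esum_(c in U) (pw s c.1)%:E <= e%:E)%E.
Proof.
rewrite /dcont content_eq0; last by move=> c; exact: pw_ge0.
split=> H e /H[U]; first by case=> _ UA Ue; exists U.
by case=> UA Ue; exists U.
Qed.

End Cubes.

(** * Lebesgue outer measure through dyadic cubes *)

Section Volume.
Context {R : realType} (k : nat).
Local Open Scope ereal_scope.
Local Notation T := 'rV[R]_k.
Local Notation vol c := ((pw (k%:R : R) c.1)%:E).

(** For the exponent [k] the 2^(J k) descendants of a cube weigh together as much as the cube, so
    refining a cover is free. *)
Lemma refine_cover (U : set (cubeidx k)) (A : set T) J : covers (@cube R k) U A ->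
  exists V, [/\ covers (@cube R k) V A, forall c, V c -> (J <= c.1)%N &
    \esum_(c in V) vol c <= \esum_(c in U) vol c].
Proof.
move=> UA.
pose g (p : cubeidx k * {ffun 'I_k -> 'I_(2 ^ J)}) : cubeidx k :=
  ((p.1.1 + J)%N, subidx p.1.2 p.2).
exists (g @` (U `*` setT)); split.
- move=> x /UA[c Uc cx]; have [e fe] := fidx_subidx c.1 J x.
  exists (g (c, e)); first by exists (c, e).
  by rewrite /cube/= fe cx.
- by move=> _ [[c e] _ <-] /=; rewrite leq_addl.
- apply: le_trans (esum_fibers U (v := fun c => pw k%:R c.1)
    (w := fun c => pw k%:R (c.1 + J)) _ _) _ => [c|//|]; first exact: pw_ge0.
  rewrite -esum_cmul//; last by move=> c; rewrite lee_fin pw_ge0.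
  apply: le_esum => c Uc.
  rewrite -EFinM lee_fin pwDn card_ffun !card_ord natrX natrX (pw_nat k J).
  by rewrite mulrCA divff ?mulr1// expf_neq0// expf_neq0.
Qed.

Definition lam : set T -> \bar R := dcont (k%:R).

Let lam_set0 : lam set0 = 0.
Proof. by apply: content_set0 => c; exact: pw_ge0. Qed.

Let lam_sigma_subadditive : sigma_subadditive lam.
Proof. by apply: content_sigma_subadditive => c; exact: pw_ge0. Qed.

HB.instance Definition _ := isOuterMeasure.Build R T lam lam_set0
  (@dcont_ge0 R k k%:R) (fun A B => @dcont_subset R k k%:R A B)
  lam_sigma_subadditive.

Lemma measurable_cube (c : cubeidx k) : lam.-caratheodory (cube c).
Proof.
apply: le_caratheodory_measurable => X.
apply: le_ereal_inf_tmp => _ [U [_ UX] <-].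
(* The cubes of [V] are at least as fine as [c], so each lies inside [c] or misses it, and [V]
   splits into covers of the two parts of [X]. *)
have [V [VX VJ VU]] := refine_cover c.1 UX.
apply: le_trans VU.
rewrite (esumID [set d | cube d `<=` @cube R k c]); last first.
  by move=> *; rewrite lee_fin pw_ge0.
apply: leeD; apply: content_le => //.
  move=> x [/VX[d Vd dx] cx]; exists d => //; split=> //.
  exact: cube_nested (VJ _ Vd) cx dx.
move=> x [/VX[d Vd dx] cx]; exists d => //; split=> // dc; exact/cx/dc.
Qed.

End Volume.

(** * Hausdorff null sets *)

Section Neighbours.
Context {R : realType}.
Implicit Types (m : nat).

Definition nbr m N (z : 'rV[int]_m) (e : {ffun 'I_m -> 'I_(N + N).+1}) :
  'rV[int]_m := \row_a (z 0 a + (e a : nat)%:Z - N%:Z).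

Lemma fidx_nbr m N j (x y : 'rV[R]_m) :
  (forall a, 2 ^+ j * `|x 0 a - y 0 a| <= N%:R) ->
  exists e, fidx j y = nbr (N := N) (fidx j x) e.
Proof.
move=> H.
have B a : fidx j x 0 a - N%:Z <= fidx j y 0 a <= fidx j x 0 a + N%:Z.
  have r0 : 0 < 2 ^+ j :> R by rewrite exprn_gt0.
  have := H a; rewrite -[X in X * _]gtr0_norm// -normrM mulrBr !mxE.
  move: (2 ^+ j * x 0 a) (2 ^+ j * y 0 a) => u v; rewrite ler_norml => /andP[h1 h2].
  have fN w : Num.floor (w + N%:R : R) = Num.floor w + N%:Z.
    by rewrite floorDrz ?natr_int// pmulrn intrKfloor.
  by rewrite lerBlDr -!fN !le_floor//; lra.
have lt a : (absz (fidx j y 0 a - fidx j x 0 a + N%:Z)%R < (N + N).+1)%N.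
  have := B a; lia.
exists [ffun a => Ordinal (lt a)]; apply/rowP => a.
rewrite [RHS]mxE ffunE /=; have := B a; lia.
Qed.

Lemma fidx_dist m j (x y : 'rV[R]_m) a : fidx j x = fidx j y ->
  `|x 0 a - y 0 a| <= (2 ^+ j)^-1.
Proof.
move=> E; have r0 : 0 < 2 ^+ j :> R by rewrite exprn_gt0.
have : fidx j x 0 a = fidx j y 0 a by rewrite E.
rewrite !mxE => E'; have := floor_itv (2 ^+ j * x 0 a).
have := floor_itv (2 ^+ j * y 0 a); rewrite -E' intrD => hy hx.
rewrite -(ler_pM2l r0) mulfV ?gt_eqF//.
rewrite -[X in X * _]gtr0_norm// -normrM mulrBr ler_norml; lra.
Qed.

End Neighbours.

Section Diameter.
Context {R : realType}.
Implicit Types (m : nat).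

Lemma coord_le_euclid m (x y : 'rV[R]_m) a : `|x 0 a - y 0 a| <= euclid_dist x y.
Proof.
rewrite -sqrtr_sqr ler_sqrt; last by apply: sumr_ge0 => *; exact: sqr_ge0.
by rewrite (bigD1 a)//= lerDl sumr_ge0// => *; exact: sqr_ge0.
Qed.

Lemma euclid_le_coord m (x y : 'rV[R]_m) (d : R) : 0 <= d ->
  (forall a, `|x 0 a - y 0 a| <= d) -> euclid_dist x y <= m%:R * d.
Proof.
move=> d0 H; rewrite -[leRHS]ger0_norm ?mulr_ge0// -sqrtr_sqr.
rewrite ler_sqrt ?sqr_ge0//.
apply: (@le_trans _ _ (\sum_(i < m) d ^+ 2)).
  by apply: ler_sum => i _; rewrite -real_normK ?num_real// lerXn2r ?nnegrE.
rewrite sumr_const card_ord -(mulr_natl (d ^+ 2)) exprMn.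
apply: ler_wpM2r; first exact: sqr_ge0.
by rewrite -natrX ler_nat; case: m {x y H} => // m; rewrite expnS expn1 leq_pmulr.
Qed.

Lemma diam_ge0 m (U : set 'rV[R]_m) : U !=set0 -> (0 <= diam U)%E.
Proof.
move=> [x Ux]; apply: le_ereal_sup_tmp; exists (euclid_dist x x)%:E.
  by exists x, x.
by rewrite lee_fin sqrtr_ge0.
Qed.

Lemma pw1E j : pw (1 : R) j = (2 ^+ j)^-1.
Proof. by have := pw_nat (R := R) 1 j; rewrite expr1. Qed.

Lemma pw1_powR s j : (pw (1 : R) j) `^ s = pw s j.
Proof.
have E t : pw t j = 2 `^ (- t * j%:R) :> R.
  by rewrite powRrM powR_mulrn ?powR_ge0.
by rewrite !E -powRrM mulN1r mulNr mulrC mulNr.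
Qed.

Lemma diam_pow_ge0 m s (U : set 'rV[R]_m) : (0 <= diam_pow s U)%E.
Proof. by rewrite /diam_pow; case: ifP => // _; exact: poweR_ge0. Qed.

Lemma diam_cube m (c : cubeidx m) : (diam (@cube R m c) <= (m%:R * pw 1 c.1)%:E)%E.
Proof.
apply: ge_ereal_sup => _ [x [y [cx cy ->]]]; rewrite lee_fin.
apply: euclid_le_coord => [|a]; first exact: pw_ge0.
by rewrite pw1E; apply: fidx_dist; rewrite cx cy.
Qed.

Lemma diam_pow_cube m s (c : cubeidx m) : 0 <= s ->
  (diam_pow s (@cube R m c) <= (m%:R `^ s * pw s c.1)%:E)%E.
Proof.
move=> s0; rewrite /diam_pow; case: ifPn => [_|/set0P/diam_ge0 d0].
  by rewrite lee_fin mulr_ge0 ?pw_ge0 ?powR_ge0.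
rewrite -pw1_powR -powRM ?pw_ge0// -poweR_EFin.
apply: gt0_ler_poweR => //; last exact: diam_cube.
  by rewrite in_itv/= d0 leey.
by rewrite in_itv/= lee_fin leey mulr_ge0 ?pw_ge0.
Qed.

Lemma hausdorff_measure_ge0 m s (A : set 'rV[R]_m) : (0 <= hausdorff_measure s A)%E.
Proof.
apply: le_ereal_sup_tmp; exists (hausdorff_pre s 1 A); first by exists 1 => /=.
apply: le_ereal_inf_tmp => _ [U [_ _ ->]]; apply: nneseries_ge0 => *.
exact: diam_pow_ge0.
Qed.

Lemma dcont0_hausdorff0 m s (A : set 'rV[R]_m) : 0 < s -> dcont s A = 0%E ->
  hausdorff_measure s A = 0%E.
Proof.
move=> s0 /dcont_eq0 H; apply/eqP; rewrite eq_le hausdorff_measure_ge0 andbT.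
apply: ge_ereal_sup => _ [delta /= d0 <-]; apply/lee_addgt0Pr => e e0.
rewrite add0e.
have [J HJ] : exists J, m%:R * pw 1 J <= delta.
  have [J HJ] := @pw_small R 1 (delta / (m%:R + 1)) ltr01 (divr_gt0 d0 (ltr_wpDl (ler0n _ m) ltr01)).
  exists J; rewrite ltr_pdivlMr ?ltr_wpDl// in HJ.
  have := pw_ge0 (1 : R) J; lra.
pose C := m%:R `^ s; have C0 : 0 <= C :> R by exact: powR_ge0.
(* The first bound absorbs the constant [C]; the second forces all cubes to level [J] or finer,
   hence to diameter at most [delta]. *)
have e'0 : 0 < Num.min (e / (C + 1)) (pw s J).
  by rewrite lt_min pw_gt0 divr_gt0// ltr_wpDl.
have [U [UA Ue]] := H _ e'0.
have UJ c : U c -> (J <= c.1)%N.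
  move=> Uc; apply: (@pw_leq R s) => //.
  rewrite -lee_fin; apply: (@le_trans _ _ (Num.min (e / (C + 1)) (pw s J))%:E).
    apply: le_trans Ue; rewrite -(@esum_set1 _ _ c (fun c => (pw s c.1)%:E))//.
      by apply: esum_subset => [_ ->//|i]; rewrite lee_fin pw_ge0.
    by rewrite lee_fin pw_ge0.
  by rewrite lee_fin ge_min lexx orbT.
pose F (i : nat) : set 'rV[R]_m := if pickle_inv i is Some c then
  (if c \in U then cube c else set0) else set0.
apply: (@le_trans _ _ (\sum_(0 <= i <oo) diam_pow s (F i))%E).
  apply: ereal_inf_lbound; exists F; split=> //.
    by move=> x /UA[c Uc cx]; exists (pickle c) => //; rewrite /F pickleK_inv mem_set.
  have D0 : (diam (set0 : set 'rV[R]_m) <= delta%:E)%E.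
    by apply: ge_ereal_sup => z [x [y [[]]]].
  move=> i; rewrite /F; case: pickle_inv => // c; case: ifP => // /set_mem /UJ Jc.
  apply: (le_trans (diam_cube c)); rewrite lee_fin; apply: le_trans HJ.
  by rewrite ler_wpM2l// pw_anti.
pose f c : \bar R := if c \in U then diam_pow s (@cube R m c) else 0%E.
have -> : (\sum_(0 <= i <oo) diam_pow s (F i) = \esum_(c in U) diam_pow s (cube c))%E.
  rewrite esum_mkcond -(nneseries_pickle (f := f)); last first.
    by move=> c; rewrite /f; case: ifP => // _; exact: diam_pow_ge0.
  apply: eq_eseriesr => i _; rewrite /F /f; case: pickle_inv => [c|].
    by case: ifP => // _; rewrite /diam_pow eqxx.
  by rewrite /diam_pow eqxx.
apply: (@le_trans _ _ (\esum_(c in U) (C%:E * (pw s c.1)%:E))%E).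
  apply: le_esum => c Uc; rewrite -EFinM.
  by apply: diam_pow_cube; exact: ltW.
rewrite esum_cmul//; last by move=> c; rewrite lee_fin pw_ge0.
apply: (@le_trans _ _ (C%:E * (e / (C + 1))%:E)%E).
  apply: lee_wpmul2l; first by rewrite lee_fin.
  by apply: (le_trans Ue); rewrite lee_fin ge_min lexx.
rewrite -EFinM lee_fin mulrCA ger_pMr// ler_pdivrMr ?ltr_wpDl// mul1r; lra.
Qed.

(** For [0 < d] a power of two within a factor 2 of [d] will do. The error [e] is for [d = 0], the
    diameter of a single point, which has no scale of its own. *)
Lemma diam_scale s (d e : R) : 0 < s -> 0 < e -> 0 <= d <= 1 ->
  exists j, d <= pw 1 j /\ pw s j <= 2 `^ s * d `^ s + e.
Proof.
move=> s0 e0 /andP[d0 d1]; have [dp|dn] := ltP 0 d.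
  have /ex_minnP[[|j] + jmin] := @pw_small R 1 d ltr01 dp; first by rewrite pw0 ltNge d1.
  move=> jd; exists j; split.
    by rewrite leNgt; apply/negP => /jmin; rewrite ltnn.
  apply: (@le_trans _ _ (2 `^ s * d `^ s)); last by rewrite lerDl ltW.
  have -> : pw s j = 2 `^ s * pw s j.+1.
    by rewrite /pw exprS mulrA -powRD ?pnatr_eq0 ?implybT// subrr powRr0 mul1r.
  rewrite -pw1_powR ler_wpM2l ?powR_ge0// ge0_ler_powR ?nnegrE ?pw_ge0 ?ltW//.
have [j je] := @pw_small R s e s0 e0.
exists j; split; first exact: le_trans dn (pw_ge0 _ _).
by rewrite (le_trans (ltW je))// lerDr mulr_ge0 ?powR_ge0.
Qed.

(** A set of diameter at most 2^(-j) lies in the 3^m neighbours of the level-[j] cube around any of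
    its points. Mesh 1 suffices, since levels start at 0. *)
Lemma hausdorff0_dcont0 m s (A : set 'rV[R]_m) : 0 < s ->
  hausdorff_measure s A = 0%E -> dcont s A = 0%E.
Proof.
move=> s0 H0; apply/dcont_eq0 => e e0.
pose K := #|{ffun 'I_m -> 'I_(1 + 1).+1}|%:R * (2 `^ s + 1) : R.
have K0 : 0 < K.
  rewrite mulr_gt0 ?ltr_wpDl ?powR_ge0//.
  by rewrite ltr0n card_ffun !card_ord expn_gt0.
have eK0 : 0 < e / K by rewrite divr_gt0.
have : (hausdorff_pre s 1 A < (e / K)%:E)%E.
  apply: (@le_lt_trans _ _ 0%E); last by rewrite lte_fin.
  by rewrite -H0; apply: ereal_sup_ubound; exists 1 => /=.
move=> /ereal_inf_lt[_ [U [UA U1 ->]] Ue].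
have /choice[r Hr] : forall i, exists p : nat * 'rV[R]_m, U i !=set0 ->
    [/\ U i p.2, (forall x y, U i x -> U i y -> euclid_dist x y <= pw 1 p.1) &
     ((pw s p.1)%:E <= (2 `^ s)%:E * diam_pow s (U i) +
        (e / K / 2 ^+ i.+1)%:E)%E].
  move=> i; have [Ui|] := pselect (U i !=set0); last by exists (0%N, 0).
  have d0 := diam_ge0 Ui; have d1 := U1 i.
  have fd : diam (U i) \is a fin_num.
    by rewrite ge0_fin_numE//; apply: le_lt_trans d1 _; rewrite ltry.
  have [j [dj pj]] : exists j, fine (diam (U i)) <= pw 1 j /\
     pw s j <= 2 `^ s * fine (diam (U i)) `^ s + e / K / 2 ^+ i.+1.
    apply: diam_scale => //; first by rewrite divr_gt0// exprn_gt0.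
    by rewrite -!lee_fin fineK// d0.
  case: (Ui) => x Ux; exists (j, x) => _; split=> //.
    move=> y z Uy Uz; apply: le_trans dj; rewrite -lee_fin fineK//.
    by apply: ereal_sup_ubound; exists y, z.
  rewrite /diam_pow ifF; last by apply/negP => /eqP; apply/eqP/set0P.
  by rewrite -(fineK fd) poweR_EFin -EFinM -EFinD lee_fin.
pose g (p : nat * {ffun 'I_m -> 'I_(1 + 1).+1}) : cubeidx m :=
  ((r p.1).1, nbr (fidx (r p.1).1 (r p.1).2) p.2).
pose W := [set i | U i !=set0].
have pw0E t j : (0 <= (pw t j : R)%:E)%E by rewrite lee_fin pw_ge0.
exists (g @` (W `*` setT)); split.
  move=> x /UA[i _ Ux]; have Wi : W i by exists x.
  have [Up Ud _] := Hr i Wi.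
  have [|ee Eee] := @fidx_nbr R m 1 (r i).1 (r i).2 x.
    move=> a; rewrite -ler_pdivlMl ?exprn_gt0// mulr1 -pw1E.
    exact: le_trans (coord_le_euclid _ _ _) (Ud _ _ Up Ux).
  by exists (g (i, ee)) => //; exists (i, ee).
apply: (@le_trans _ _ (\esum_(p in W `*`` fun=> setT) (pw s (g p).1)%:E)%E).
  by apply: (esum_le_cover (e := g)) => // p; rewrite lee_fin pw_ge0.
rewrite -(esum_esum (a := fun i c => (pw s (g (i, c)).1)%:E))//.
pose C := #|{ffun 'I_m -> 'I_(1 + 1).+1}|%:R : R.
have C0 : 0 <= C by rewrite /C.
pose b i := ((2 `^ s)%:E * diam_pow s (U i) + (e / K / 2 ^+ i.+1)%:E)%E.
have b0 i : (0 <= b i)%E.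
  apply: adde_ge0; last by rewrite lee_fin divr_ge0 ?exprn_ge0// ltW.
  by apply: mule_ge0 (diam_pow_ge0 _ _); rewrite lee_fin powR_ge0.
apply: (@le_trans _ _ (\esum_(i in W) (C%:E * b i)%E)).
  apply: le_esum => i Wi; apply: (@le_trans _ _ (C * pw s (r i).1)%:E).
    by apply: esum_fin => //; exact: pw_ge0.
  rewrite EFinM; apply: lee_wpmul2l; first by rewrite lee_fin.
  by have [] := Hr i Wi.
rewrite esum_cmul//.
apply: (@le_trans _ _ (C%:E * ((2 `^ s + 1) * (e / K))%:E)%E); last first.
  have E : C * ((2 `^ s + 1) * (e / K)) = e.
    by rewrite mulrA -[X in X * _]/K mulrC divfK// gt_eqF.
  by rewrite -EFinM lee_fin E.
apply: lee_wpmul2l; first by rewrite lee_fin.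
apply: (@le_trans _ _ (\esum_(i in [set: nat]) b i)); first exact: esum_subset.
rewrite esumD; last 2 first.
- move=> i _; apply: mule_ge0 (diam_pow_ge0 _ _); by rewrite lee_fin powR_ge0.
- by move=> i _; rewrite lee_fin divr_ge0 ?exprn_ge0// ltW.
rewrite mulrDl mul1r EFinD; apply: leeD; last exact: esum_eps (ltW eK0).
rewrite esum_cmul ?powR_ge0//; last by move=> i; exact: diam_pow_ge0.
rewrite EFinM; apply: lee_wpmul2l; first by rewrite lee_fin powR_ge0.
rewrite -nneseries_esumT; last by move=> i; exact: diam_pow_ge0.
exact: ltW.
Qed.

End Diameter.

(** * Covers depending on a base point *)

Section Caratheodory.
Context {R : realType} {k : nat}.
Local Open Scope ereal_scope.
Local Notation lam := (@lam R k).
Local Notation mbl := (lam.-caratheodory).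
Implicit Types A B : set 'rV[R]_k.

Definition lam_outer : {outer_measure set 'rV[R]_k -> \bar R} := lam.

Definition lam_measure : {measure set (caratheodory_type lam_outer) -> \bar R} :=
  (lam_outer : set (caratheodory_type lam_outer) -> \bar R).

Lemma lam_ge0 A : 0 <= lam A. Proof. exact: dcont_ge0. Qed.

Lemma le_lam A B : A `<=` B -> lam A <= lam B. Proof. exact: dcont_subset. Qed.

Lemma mbl_set0 : mbl set0. Proof. exact: caratheodory_measurable_set0. Qed.

Lemma mblC A : mbl A -> mbl (~` A).
Proof. exact: caratheodory_measurable_setC. Qed.

Lemma mblU A B : mbl A -> mbl B -> mbl (A `|` B).
Proof. exact: caratheodory_measurable_setU. Qed.

Lemma mblI A B : mbl A -> mbl B -> mbl (A `&` B).
Proof. exact: caratheodory_measurable_setI. Qed.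

Lemma mblD A B : mbl A -> mbl B -> mbl (A `\` B).
Proof. exact: caratheodory_measurable_setD. Qed.

Lemma mbl_bigcup (J : countType) (K : set J) (F : J -> set 'rV[R]_k) :
  (forall j, K j -> mbl (F j)) -> mbl (\bigcup_(j in K) F j).
Proof.
move=> mF; rewrite bigcup_mkcond.
apply: (@countable_bigcupT_measurable _ (caratheodory_type lam) J) => //.
move=> j; case: ifPn => [/set_mem/mF//|_]; exact: mbl_set0.
Qed.

Lemma mbl_bigcap (F : nat -> set 'rV[R]_k) (K : set nat) :
  (forall j, K j -> mbl (F j)) -> mbl (\bigcap_(j in K) F j).
Proof.
move=> mF; rewrite -(setCK (\bigcap_(j in K) F j)) setC_bigcap.
by apply/mblC/mbl_bigcup => j Kj; exact/mblC/mF.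
Qed.

Lemma lamUI A B : mbl A -> lam (A `|` B) + lam (A `&` B) = lam A + lam B.
Proof.
move=> mA; rewrite (mA (A `|` B)) (mA B) (setIC B A).
have -> : (A `|` B) `&` A = A by rewrite setIC setIUr setIid setUidl// => x [].
have -> : (A `|` B) `&` ~` A = B `&` ~` A.
  by rewrite setIUl setICr set0U.
by rewrite -addeA (addeC (lam (B `&` _))).
Qed.

End Caratheodory.

Section ProductContent.
Context {R : realType} {k n : nat}.
Variable s : R.
Local Open Scope ereal_scope.
Local Notation lam := (@lam R k).
Local Notation mbl := (lam.-caratheodory).
Local Notation fam := (cubeidx n -> set 'rV[R]_k).
Implicit Types (A B : set 'rV[R]_(k + n)) (T S : fam).

Definition prodcube (p : cubeidx k * cubeidx n) : set 'rV[R]_(k + n) :=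
  [set x | cube p.1 (lsubmx x) /\ cube p.2 (rsubmx x)].

(* A cover of [A] by products [I * Q] is the same as a family of sets [T Q] that
   are unions of cubes, such that the [Q] with [t] in [T Q] cover the slice of [A]
   at [t]; the weight is the integral over [t] of the sum of the diam(Q)^s. *)
Definition cap : set 'rV[R]_(k + n) -> \bar R :=
  content setT prodcube (fun p => pw k%:R p.1.1 * pw s p.2.1)%R.

Let w0 (p : cubeidx k * cubeidx n) : (0 <= pw k%:R p.1.1 * pw s p.2.1 :> R)%R.
Proof. by rewrite mulr_ge0 ?pw_ge0. Qed.

Lemma cap_ge0 A : 0 <= cap A. Proof. exact: content_ge0. Qed.

Lemma cap_subset A B : A `<=` B -> cap A <= cap B.
Proof. exact: content_subset. Qed.

Lemma cap_bigcup0 (J : countType) (K : set J) (A : J -> set 'rV[R]_(k + n)) :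
  (forall j, K j -> cap (A j) = 0) -> cap (\bigcup_(j in K) A j) = 0.
Proof. exact: content_bigcup0. Qed.

Definition famset T : set 'rV[R]_(k + n) :=
  [set x | exists2 Q, T Q (lsubmx x) & cube Q (rsubmx x)].

Definition cost T : \bar R := \esum_(Q in setT) ((pw s Q.1)%:E * lam (T Q)).

Lemma cap_rect (D : set 'rV[R]_k) (Q : cubeidx n) :
  cap [set x | D (lsubmx x) /\ cube Q (rsubmx x)] <= (pw s Q.1)%:E * lam D.
Proof.
rewrite -lee_pdivrMl ?pw_gt0//; apply: le_ereal_inf_tmp => _ [U [_ UT] <-].
rewrite lee_pdivrMl ?pw_gt0//.
apply: (@le_trans _ _ (\esum_(c in U) ((pw s Q.1)%:E * (pw k%:R c.1)%:E))).
  apply: (@le_trans _ _ (\esum_(p in [set (c, Q) | c in U])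
      (pw k%:R p.1.1 * pw s p.2.1)%:E)).
    apply: content_le => // x [/UT[c Uc cx] Qx]; exists (c, Q) => //.
    by exists c.
  rewrite esum_image; last by move=> x y _ _ [].
  by apply: le_esum => c _ /=; rewrite -EFinM mulrC.
by rewrite esum_cmul ?pw_ge0// => c; rewrite lee_fin pw_ge0.
Qed.

Lemma cap_bigcup (J : countType) (K : set J) (A : J -> set 'rV[R]_(k + n)) :
  cap (\bigcup_(j in K) A j) <= \esum_(j in K) cap (A j).
Proof. exact: content_bigcup. Qed.

(** The sets [T Q] are arbitrary here; each is covered by cubes separately. With [cap_family], [cap]
    is the infimum of [cost] over measurable families. *)
Lemma cap_le_cost T A : A `<=` famset T -> cap A <= cost T.
Proof.
move=> AT; pose F (Q : cubeidx n) :=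
  [set x : 'rV[R]_(k + n) | T Q (lsubmx x) /\ cube Q (rsubmx x)].
apply: (@le_trans _ _ (cap (\bigcup_(Q in setT) F Q))).
  by apply: cap_subset => x /AT[Q TQ Qx]; exists Q.
apply: (le_trans (cap_bigcup _ _)); apply: le_esum => Q _; exact: cap_rect.
Qed.

Lemma cap_family A e : cap A < e -> exists T, [/\ forall Q, mbl (T Q),
  A `<=` famset T & cost T < e].
Proof.
move=> /content_lt[U [_ UA Ue]].
pose T (Q : cubeidx n) := \bigcup_(c in [set c | U (c, Q)]) @cube R k c.
exists T; split.
- by move=> Q; apply: mbl_bigcup => c _; exact: measurable_cube.
- by move=> x /UA[[c Q] Ui [cx Qx]]; exists Q => //; exists c.
- apply: le_lt_trans Ue.
  apply: (@le_trans _ _ (\esum_(Q in setT) \esum_(c in [set c | U (c, Q)])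
     (pw k%:R c.1 * pw s Q.1)%:E)).
    apply: le_esum => Q _; rewrite -lee_pdivlMl ?pw_gt0//.
    apply: (le_trans (dcont_bigcup _ _ _)).
    apply: (@le_trans _ _ (\esum_(c in [set c | U (c, Q)]) (pw k%:R c.1)%:E)).
      by apply: le_esum => c _; exact: dcont_cube.
    rewrite lee_pdivlMl ?pw_gt0// -esum_cmul ?pw_ge0//; last first.
      by move=> c; rewrite lee_fin pw_ge0.
    by apply: le_esum => c _; rewrite -EFinM mulrC.
  rewrite esum_esum; last by move=> *; rewrite lee_fin mulr_ge0 ?pw_ge0.
  apply: (esum_le_cover (e := fun p => (p.2, p.1))) => //.
    by move=> [Q c] [_ Uc]; exists (c, Q).
Qed.

End ProductContent.

(** * Strong subadditivity and increasing sequences of sets *)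

Section Increasing.
Context {R : realType} {k n : nat}.
Variable s : R.
Local Open Scope ereal_scope.
Local Notation lam := (@lam R k).
Local Notation mbl := (lam.-caratheodory).
Local Notation fam := (cubeidx n -> set 'rV[R]_k).
Local Notation cost := (@cost R k n s).
Local Notation cap := (@cap R k n s).
Implicit Types (A B : set 'rV[R]_(k + n)) (T S : fam).

Definition strict_anc (Q : cubeidx n) : set (cubeidx n) :=
  [set Q' | (Q'.1 < Q.1)%N /\ @cube R n Q `<=` cube Q'].

Definition has_anc T S Q : set 'rV[R]_k :=
  \bigcup_(Q' in strict_anc Q) (T Q' `|` S Q').

(** Over each base point only the outermost cubes of both families are kept; they still cover
    everything. [fmeet] collects the cubes that occur in both families or lie inside another one. *)
Definition fjoin T S : fam := fun Q => (T Q `|` S Q) `\` has_anc T S Q.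

Definition fmeet T S : fam := fun Q =>
  (T Q `&` S Q) `|` ((T Q `|` S Q) `&` has_anc T S Q).

Lemma mbl_fjoin T S : (forall Q, mbl (T Q)) -> (forall Q, mbl (S Q)) ->
  forall Q, mbl (fjoin T S Q).
Proof.
move=> mT mS Q; apply: mblD; first exact: mblU.
by apply: mbl_bigcup => Q' _; exact: mblU.
Qed.

(* Davies' strong subadditivity, whence the continuity of [cap] along increasing
   sequences. *)
Lemma cost_join_meet T S : (forall Q, mbl (T Q)) -> (forall Q, mbl (S Q)) ->
  cost (fjoin T S) + cost (fmeet T S) <= cost T + cost S.
Proof.
move=> mT mS.
have g0 V Q : 0 <= (pw s Q.1)%:E * lam (V Q).
  by rewrite mule_ge0 ?lam_ge0// lee_fin pw_ge0.
rewrite /cost -!esumD//; apply: le_esum => Q _.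
rewrite -!ge0_muleDr ?lam_ge0//; apply: lee_wpmul2l; first by rewrite lee_fin pw_ge0.
(* At each [Q], join and meet have their union inside that of [T] and [S], and their intersection
   inside theirs; modularity of [lam] concludes. *)
rewrite -lamUI; last exact: mbl_fjoin.
rewrite -(lamUI _ (mT Q)); apply: leeD; apply: le_lam => x.
  by case=> [[]//|[[Tx _]|[]//]]; left.
move=> [[TS nanc]] [//|[_ anc]]; exfalso; exact: nanc.
Qed.

(* At a fixed base point the cubes are nested or disjoint, so two cubes of [T]
   and [S] containing the same point are equal or the smaller one has an ancestor. *)
Lemma famset_meet T S : famset T `&` famset S `<=` famset (fmeet T S).
Proof.
move=> x [[Q TQ Qx] [Q' SQ' Q'x]].
have [lt|gt|eq] := ltngtP Q.1 Q'.1.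
- exists Q' => //; right; split; first by right.
  exists Q; last by left.
  by split=> //; exact: cube_nested (ltnW lt) Qx Q'x.
- exists Q => //; right; split; first by left.
  exists Q'; last by right.
  by split=> //; exact: cube_nested (ltnW gt) Q'x Qx.
- have E : Q = Q'.
    case: Q Q' eq Qx Q'x {TQ SQ'} => [j z] [j' z'] /= <-.
    by rewrite /cube/= => -> ->.
  by exists Q => //; left; split=> //; rewrite E.
Qed.

(** The coarsest cube over [t] that contains [y] survives in the join, so along iterated joins the
    least level at which a point is covered never increases. *)
Lemma fjoin_level T S t y Q : (T Q `|` S Q) t -> cube Q y ->
  exists Q', [/\ (Q'.1 <= Q.1)%N, fjoin T S Q' t & @cube R n Q' y].
Proof.
move=> TSQ Qy.
pose P l := `[< exists Q', [/\ Q'.1 = l, (T Q' `|` S Q') t & @cube R n Q' y] >].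
have exP : exists l, P l by exists Q.1; apply/asboolP; exists Q.
case: (ex_minnP exP) => l /asboolP[Q' [lE TS Q'y]] lmin.
exists Q'; split=> //; first by rewrite lE; apply: lmin; apply/asboolP; exists Q.
split=> // -[Q'' [lt sub] TS'].
have /lmin : P Q''.1 by apply/asboolP; exists Q''; split=> //; exact: sub.
by rewrite -lE leqNgt lt.
Qed.

Lemma cost_nondecreasing (D : nat -> fam) (b : \bar R) :
  (forall N Q, mbl (D N Q)) ->
  (forall N M Q, (N <= M)%N -> D N Q `<=` D M Q) ->
  (forall N, cost (D N) <= b) -> cost (fun Q => \bigcup_N D N Q) <= b.
Proof.
move=> mD incD Db; apply: ge_ereal_sup => _ [X [finX _] <-].
rewrite fsbig_finite//=; move Er : (finmap.enum_fset _) => r.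
have cv Q : (fun N => (pw s Q.1)%:E * lam (D N Q)) @ \oo -->
    (pw s Q.1)%:E * lam (\bigcup_N D N Q).
  apply: cvgeZl => //.
  apply: (@nondecreasing_cvg_mu _ _ _ (@lam_measure R k) (D^~ Q)) => //.
  - by move=> N; exact: mD.
  - exact: (@mbl_bigcup R k nat setT (D^~ Q) (fun N _ => mD N Q)).
  - by move=> N M NM; apply/subsetPset; exact: incD.
have g0 N Q : 0 <= (pw s Q.1)%:E * lam (D N Q).
  by rewrite mule_ge0 ?lam_ge0// lee_fin pw_ge0.
have cvS : (fun N => \sum_(Q <- r) (pw s Q.1)%:E * lam (D N Q)) @ \oo -->
    \sum_(Q <- r) (pw s Q.1)%:E * lam (\bigcup_N D N Q).
  apply: cvg_nnesum => [Q _|Q _]; last exact: cv.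
  by apply: nearW => N; exact: g0.
apply: (cvge_le _ cvS).
apply: nearW => N; apply: le_trans (Db N).
apply: esum_ge; exists X; first by split.
by rewrite fsbig_finite//= Er.
Qed.

(** Nearly optimal families for the [A i] are joined successively. The meet of [W i] and [T i.+1]
    covers [A i] and so costs at least [c i]; strong subadditivity then lets each join raise the
    bound on the cost only by [c i.+1 - c i] and an error. The errors sum to at most [e]. *)
Lemma cap_nondecreasing_bigcup (A : nat -> set 'rV[R]_(k + n)) (a : R) :
  (forall i, A i `<=` A i.+1) -> (forall i, cap (A i) <= a%:E) ->
  cap (\bigcup_i A i) <= a%:E.
Proof.
move=> incA Aa; apply/lee_addgt0Pr => e e0.
have fA i : cap (A i) \is a fin_num.
  by rewrite ge0_fin_numE ?cap_ge0//; apply: le_lt_trans (Aa i) _; rewrite ltry.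
pose c i := fine (cap (A i)).
have cE i : cap (A i) = (c i)%:E by rewrite fineK.
have ca i : (c i <= a)%R by rewrite -lee_fin -cE.
have h0 i : (0 < e / 2 ^+ i.+1)%R by rewrite divr_gt0// exprn_gt0.
have hS i : (e / 2 ^+ i.+1 = 2 * (e / 2 ^+ i.+2))%R.
  rewrite [in RHS]exprS invfM; field; exact: expf_neq0.
have /choice[T HT] : forall i, exists T : fam, [/\ forall Q, mbl (T Q),
    A i `<=` famset T & cost T < (c i + e / 2 ^+ i.+1)%:E].
  by move=> i; apply: cap_family; rewrite cE lte_fin ltrDl.
have mT i Q : mbl (T i Q) by have [] := HT i.
pose W := fix W i := if i is j.+1 then fjoin (W j) (T j.+1) else T 0%N.
have mW i Q : mbl (W i Q).
  by elim: i Q => [|i IH] Q /=; [exact: mT|exact: mbl_fjoin].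
have AW i : A i `<=` famset (W i).
  elim: i => [|i IH] /=; first by have [] := HT 0%N.
  move=> x Ax; have [_ /(_ x Ax)[Q TQ Qx] _] := HT i.+1.
  have [|Q' [_ Q'1 Q'2]] := @fjoin_level (W i) (T i.+1) (lsubmx x) (rsubmx x) Q _ Qx.
    by right.
  by exists Q'.
have costW i : cost (W i) <= (c i + e - e / 2 ^+ i.+1)%:E.
  elim: i => [|i IH].
    have [_ _ /ltW/le_trans] := HT 0%N; apply.
    by rewrite lee_fin expr1; lra.
  have JM := cost_join_meet (mW i) (mT i.+1).
  have [_ AT /ltW cT] := HT i.+1.
  have M : (c i)%:E <= cost (fmeet (W i) (T i.+1)).
    rewrite -cE; apply: cap_le_cost => x Ax; apply: famset_meet; split.
      exact: AW.
    exact/AT/incA.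
  have : cost (W i.+1) + (c i)%:E <=
      ((c i + e - e / 2 ^+ i.+1) + (c i.+1 + e / 2 ^+ i.+2))%:E.
    apply: (le_trans _ (le_trans JM _)); first exact: leeD2l.
    by rewrite EFinD; exact: leeD.
  rewrite -leeBrDr// -EFinB; move/le_trans; apply; rewrite lee_fin (hS i); lra.
(* The joins are not monotone, as cubes give way to coarser ones; the limit family is their lower
   limit. It covers [x], because the cube of least level that any [W i] with [N <= i] uses at [x]
   can no longer be replaced. *)
pose D N Q := \bigcap_(i in [set i | (N <= i)%N]) W i Q.
apply: (@le_trans _ _ (cost (fun Q => \bigcup_N D N Q))).
  apply: cap_le_cost => x [N _ AN].
  pose P l := `[< exists i Q, [/\ (N <= i)%N, Q.1 = l, W i Q (lsubmx x) & @cube R n Q (rsubmx x)] >].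
  have exP : exists l, P l.
    have [Q WQ Qx] := AW N x AN; exists Q.1; apply/asboolP; by exists N, Q.
  case: (ex_minnP exP) => l /asboolP[i [Q [Ni lE WQ Qx]]] lmin.
  exists Q => //; exists i => // j /= ij.
  have [Q' [Q'l WQ' Q'x]] : exists Q', [/\ (Q'.1 <= Q.1)%N, W j Q' (lsubmx x) &
      @cube R n Q' (rsubmx x)].
    rewrite -(subnKC ij); elim: (j - i)%N => [|d [Q' [IH1 IH2 IH3]]].
      by rewrite addn0; exists Q.
    rewrite addnS /=.
    have [|Q'' [h1 h2 h3]] := @fjoin_level (W (i + d)%N) (T (i + d).+1) (lsubmx x) (rsubmx x) Q' _ IH3.
      by left.
    by exists Q''; split=> //; exact: leq_trans h1 IH1.
  have lE' : Q'.1 = Q.1.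
    apply/eqP; rewrite eqn_leq Q'l lE; apply: lmin; apply/asboolP.
    by exists j, Q'; split=> //; exact: leq_trans ij.
  suff -> : Q = Q' by [].
  case: Q Q' lE' Qx Q'x {lE WQ WQ' Q'l} => [p z] [p' z'] /= ->.
  by rewrite /cube/= => -> ->.
apply: cost_nondecreasing.
- by move=> N Q; apply: mbl_bigcap.
- by move=> N M Q NM t DN i Mi; apply: DN; exact: leq_trans NM Mi.
- move=> N; apply: (@le_trans _ _ (cost (W N))).
    apply: le_esum => Q _; apply: lee_wpmul2l; first by rewrite lee_fin pw_ge0.
    by apply: le_lam => t; apply => /=.
  apply: (le_trans (costW N)); rewrite -EFinD lee_fin.
  by have := ca N; have := h0 N; lra.
Qed.

End Increasing.

(** * Capacitability of Borel sets *)

(* Koenig's lemma: finitely many choices in each column leave a branch that is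
   followed by infinitely many rows. *)
Lemma koenig (D : eqType) (F : nat -> seq D) (u : nat -> nat -> D) :
  (forall n i, (i < n)%N -> u n i \in F i) ->
  exists v : nat -> D, (forall i, v i \in F i) /\
    forall j N, exists2 n, (N <= n)%N & forall i, (i < j)%N -> u n i = v i.
Proof.
move=> uF; pose d0 := u 0%N 0%N.
pose P (w : seq D) := forall N, exists2 n, (N <= n)%N &
  forall i, (i < size w)%N -> u n i = nth d0 w i.
have ext w : exists d, P w -> d \in F (size w) /\ P (rcons w d).
  have [Pw|] := pselect (P w); last by exists d0.
  apply: contrapT => /forallNP H.
  have /choice[N HN] : forall d, exists N, d \in F (size w) ->
      forall n, (N <= n)%N -> ~ (forall i, (i < (size w).+1)%N -> u n i = nth d0 (rcons w d) i).
    move=> d; have [dF|] := boolP (d \in F (size w)); last by exists 0%N.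
    have := H d; move=> /not_implyP[_] /not_andP[//|].
    move=> /existsNP[N HN]; exists N => _ n Nn Hn; apply: HN; exists n => //.
    by rewrite size_rcons.
  have [n + Hn] := Pw (maxn (size w).+1 (\max_(d <- F (size w)) N d)).
  rewrite geq_max => /andP[wn Nn].
  have dF := uF n (size w) wn.
  apply: (HN _ dF n); first by apply: leq_trans Nn; exact: leq_bigmax_seq.
  move=> i; rewrite ltnS leq_eqVlt nth_rcons => /predU1P[->|iw]; last by rewrite iw Hn.
  by rewrite ltnn eqxx.
have [g Hg] := choice ext.
pose S := fix S n := if n is m.+1 then rcons (S m) (g (S m)) else [::].
have sS n : size (S n) = n by elim: n => //= n IH; rewrite size_rcons IH.
have PS n : P (S n).
  elim: n => [|n IH] /=; first by move=> N; exists N.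
  by have [] := Hg _ IH.
pose v i := g (S i).
have nS n i : (i < n)%N -> nth d0 (S n) i = v i.
  elim: n => // n IH; rewrite ltnS /= nth_rcons sS.
  by rewrite leq_eqVlt => /predU1P[->|ln]; [rewrite ltnn eqxx|rewrite ln IH].
exists v; split=> [i|j N]; first by have := Hg _ (PS i); rewrite sS => -[].
have [n Nn Hn] := PS j N; exists n => // i ij.
by rewrite Hn ?sS// nS.
Qed.

Section Souslin.
Context {R : realType} {m : nat}.
Local Notation T := 'rV[R]_m.
Implicit Types A B : set T.

(* A projection of a closed subset of [T * nat^nat]: the closed sets [F n s]
   depend only on finitely many coordinates of [s]. *)
Definition souslin_scheme (F : nat -> (nat -> nat) -> set T) :=
  (forall n s, closed (F n s)) /\
  (forall n s, exists b, forall t, (forall i, (i < b)%N -> s i = t i) ->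
     F n s = F n t).

Definition souslin A := exists F, souslin_scheme F /\
  A = [set x | exists s, forall n, F n s x].

Lemma souslin_closed A : closed A -> souslin A.
Proof.
move=> cA; exists (fun _ _ => A); split; first by split=> // n s; exists 0%N.
by apply/seteqP; split=> x; [exists id|case=> s /(_ 0%N)].
Qed.

Lemma souslin_bigcup (A : nat -> set T) : (forall i, souslin (A i)) ->
  souslin (\bigcup_i A i).
Proof.
move=> /choice[F HF].
exists (fun n s => F (s 0%N) n (fun i => s i.+1)); split.
  split=> n s; first by have [[]] := HF (s 0%N).
  have [[_ /(_ n (fun i => s i.+1))[b Hb]] _] := HF (s 0%N).
  exists b.+1 => t st; rewrite -(st 0%N)//; apply: Hb => i ib; exact: st.
apply/seteqP; split=> [x [i _]|x [s Hs]].
  rewrite (HF i).2 => -[s Hs].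
  by exists (fun j => if j is j'.+1 then s j' else i).
by exists (s 0%N) => //; rewrite (HF _).2; exists (fun i => s i.+1).
Qed.

(** A single branch [s] codes a whole sequence of branches, [sub s i] being the one that witnesses
    membership in [A i]. *)
Lemma souslin_bigcap (A : nat -> set T) : (forall i, souslin (A i)) ->
  souslin (\bigcap_i A i).
Proof.
move=> /choice[F HF].
pose sub (s : nat -> nat) (i : nat) := fun l : nat => s (pickle (i, l)).
exists (fun N s => if unpickle N is Some (i, n) then F i n (sub s i) else setT); split.
  split=> N s; case: unpickle => [[i n]|]; do ?[exact: closedT|by exists 0%N].
    by have [[]] := HF i.
  have [[_ /(_ n (sub s i))[b Hb]] _] := HF i.
  exists (\max_(l < b) (pickle (i, nat_of_ord l)).+1)%N => t st.
  apply: Hb => l lb; apply: st.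
  exact: (@leq_bigmax _ (fun l : 'I_b => (pickle (i, nat_of_ord l)).+1) (Ordinal lb)).
apply/seteqP; split=> [x Ax|x [s Hs] i _].
  have /choice[s Hs] : forall i, exists s, forall n, F i n s x.
    by move=> i; have := Ax i I; rewrite (HF i).2.
  exists (fun N => if unpickle N is Some (i, l) then s i l else 0%N) => N.
  case: unpickle => [[i n]|//].
  have -> : sub (fun N => if unpickle N is Some (i, l) then s i l else 0%N) i = s i.
    by apply/funext => l; rewrite /sub pickleK.
  exact: Hs.
rewrite (HF i).2; exists (sub s i) => n.
by have := Hs (pickle (i, n)); rewrite pickleK.
Qed.

Lemma souslin_open A : open A -> souslin A.
Proof.
move=> oA.
pose C (i : nat) := [set x : T | forall y, `|y - x| < i.+1%:R^-1 -> A y].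
have -> : A = \bigcup_i C i.
  apply/seteqP; split=> [x Ax|x [i _ Cx]]; last first.
    by apply: Cx; rewrite subrr normr0 invr_gt0.
  have : nbhs x A by exact: open_nbhs_nbhs.
  move=> /nbhs_ballP[e /= e0 eA].
  have [i Hi] : exists i, i.+1%:R^-1 < e.
    have [i _ Hi] := near_infty_natSinv_lt (PosNum e0).
    by exists i; apply: (Hi i) => /=.
  exists i => // y yx; apply: eA; rewrite -ball_normE /ball_ /= distrC.
  exact: lt_trans Hi.
apply: souslin_bigcup => i; apply: souslin_closed.
have -> : C i = ~` \bigcup_(y in ~` A) ball y i.+1%:R^-1.
  apply/seteqP; split=> [x Cx [y nAy]|x nx y yx].
    by rewrite -ball_normE /ball_ /= => /Cx.
  apply: contrapT => nA; apply: nx; exists y => //.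
  by rewrite -ball_normE.
by apply: open_closedC; apply: bigcup_open => y _; exact: ball_open.
Qed.

(** Souslin sets need not be stable under complement, so the sigma-algebra used consists of those
    whose complement is Souslin too. *)
Lemma borel_souslin A : borel_set A -> souslin A.
Proof.
move=> bA; suff [] : [set A | souslin A /\ souslin (~` A)] A by [].
apply: bA; split; last first.
  by move=> U /= oU; split; [exact: souslin_open|exact/souslin_closed/open_closedC].
split.
- by split; apply: souslin_closed; rewrite ?setC0; [exact: closed0|exact: closedT].
- by move=> B [sB sCB]; rewrite setTD; split; rewrite ?setCK.
- move=> B HB; split; first by apply: souslin_bigcup => i; have [] := HB i.
  by rewrite setC_bigcup; apply: souslin_bigcap => i; have [] := HB i.
Qed.

Lemma souslin_setI A B : souslin A -> souslin B -> souslin (A `&` B).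
Proof.
move=> sA sB.
have -> : A `&` B = \bigcap_i (if i is 0%N then A else B).
  apply/seteqP; split=> [x [Ax Bx] [|i] _ //|x H].
  by split; [exact: (H 0%N)|exact: (H 1%N)].
by apply: souslin_bigcap => -[|i].
Qed.

(** Branches bounded by [h] form a compact space: Koenig's lemma supplies a limit branch, and
    compactness of [D] a limit point along the same subsequence. They fit together because each
    [F l s] is closed and reads finitely many entries of [s]. *)
Lemma scheme_limit F (D : set T) (h : nat -> nat) (x : nat -> T)
    (u : nat -> nat -> nat) : souslin_scheme F -> compact D ->
  (forall n, D (x n)) -> (forall n l, F l (u n) (x n)) ->
  (forall n i, (i < n)%N -> (u n i <= h i)%N) ->
  exists y s, [/\ D y, forall i, (s i <= h i)%N, forall l, F l s y &
    forall C, closed C -> (exists N, forall n, (N <= n)%N -> C (x n)) -> C y].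
Proof.
move=> [cF dF] cD Dx Fx uh.
have [|s [sh Hs]] := @koenig _ (fun i => iota 0 (h i).+1) u.
  by move=> n i ni; rewrite mem_iota /= add0n ltnS uh.
have /choice[g Hg] : forall j, exists n, (j <= n)%N /\
    forall i, (i < j)%N -> u n i = s i.
  by move=> j; have [n jn Hn] := Hs j j; exists n.
have [] := cD ((x \o g) @ \oo) _ _.
  by exists 0%N => // n _ /=; exact: Dx.
move=> y [Dy cy].
have lim C : closed C -> (exists N, forall j, (N <= j)%N -> C (x (g j))) -> C y.
  move=> cC [N HN]; apply: cC => U Uy.
  by apply: cy => //; exists N => // j /= /HN.
exists y, s; split=> //.
- by move=> i; have := sh i; rewrite mem_iota /= add0n ltnS.
- move=> l; apply: lim; first exact: cF.
  have [b Hb] := dF l s; exists b => j bj.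
  rewrite (Hb (u (g j))); first exact: Fx.
  by move=> i ib; rewrite (Hg j).2//; exact: leq_trans bj.
- move=> C cC [N HN]; apply: lim => //; exists N => j Nj; apply: HN.
  exact: leq_trans (Hg j).1.
Qed.

(** Choquet's argument. The entries of the branches are bounded one at a time, each bound [h i]
    large enough for [c] to stay above [a]; [K] consists of the points with a branch below [h]. By
    [scheme_limit] an open set containing [K] contains some [B (S n)]. Nothing is assumed of [c]
    along decreasing sequences, hence a conclusion about open sets rather than about [K] itself. *)
Lemma capacitability (c : set T -> \bar R) (D A : set T) (a : R) :
  (forall B B', B `<=` B' -> (c B <= c B')%E) ->
  (forall B : nat -> set T, (forall i, B i `<=` B i.+1) ->
     (forall i, (c (B i) <= a%:E)%E) -> (c (\bigcup_i B i) <= a%:E)%E) ->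
  compact D -> A `<=` D -> souslin A -> (a%:E < c A)%E ->
  exists K, [/\ compact K, K `<=` A &
    forall U, open U -> K `<=` U -> (a%:E < c U)%E].
Proof.
move=> c_mono c_inc cD AD [F [sF AE]] ac.
pose B (w : seq nat) := [set x | exists s, (forall i, (i < size w)%N ->
  (s i <= nth 0%N w i)%N) /\ forall n, F n s x].
have ext w : exists l, (a%:E < c (B w))%E -> (a%:E < c (B (rcons w l)))%E.
  have [acw|] := pselect (a%:E < c (B w))%E; last by exists 0%N.
  apply: contrapT => /forallNP H; move: acw; apply/negP; rewrite -leNgt.
  have -> : B w = \bigcup_l B (rcons w l).
    apply/seteqP; split=> [x [s [Hs Fs]]|x [l _ [s [Hs Fs]]]].
      exists (s (size w)) => //; exists s; split=> // i.
      rewrite size_rcons ltnS leq_eqVlt nth_rcons => /predU1P[->|iw].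
        by rewrite ltnn eqxx.
      by rewrite iw Hs.
    exists s; split=> // i iw; have := Hs i; rewrite size_rcons nth_rcons iw.
    by apply; rewrite ltnS ltnW.
  apply: c_inc => [l x [s [Hs Fs]]|l].
    exists s; split=> // i; rewrite size_rcons => iw.
    have := Hs i; rewrite size_rcons => /(_ iw); rewrite !nth_rcons.
    by case: ifP => // _; case: ifP => // _ /leq_trans; apply.
  by rewrite leNgt; apply/negP => Hl; apply: (H l).
have [g Hg] := choice ext.
pose S := fix S n := if n is m.+1 then rcons (S m) (g (S m)) else [::].
have sS n : size (S n) = n by elim: n => //= n IH; rewrite size_rcons IH.
have cS n : (a%:E < c (B (S n)))%E.
  elim: n => [|n IH] /=; last exact: Hg.
  apply: (lt_le_trans ac); apply: c_mono => x; rewrite AE => -[s Hs]; by exists s.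
pose h i := g (S i).
have nS n i : (i < n)%N -> nth 0%N (S n) i = h i.
  elim: n => // n IH; rewrite ltnS /= nth_rcons sS.
  by rewrite leq_eqVlt => /predU1P[->|ln]; [rewrite ltnn eqxx|rewrite ln IH].
pose K := [set x | exists s, (forall i, (s i <= h i)%N) /\ forall l, F l s x].
have KA : K `<=` A by move=> x [s [_ Fs]]; rewrite AE; exists s.
exists K; split=> //.
- apply: (subclosed_compact _ cD); last by move=> x /KA/AD.
  move=> x clx.
  have /choice[y Hy] : forall n : nat, exists y, K y /\ `|x - y| < n.+1%:R^-1.
    move=> n; have n0 : 0 < n.+1%:R^-1 :> R by rewrite invr_gt0.
    have [y [Ky xy]] := clx (ball x n.+1%:R^-1) (nbhsx_ballx _ _ n0).
    by exists y; split=> //; move: xy; rewrite -ball_normE.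
  have /choice[s Hs] : forall n, exists s, (forall i, (s i <= h i)%N) /\ forall l, F l s (y n).
    by move=> n; have [] := Hy n.
  have [|||z [t [Dz th Ft zlim]]] := @scheme_limit F D h y s sF cD.
  + by move=> n; apply/AD/KA; have [] := Hy n.
  + by move=> n l; have [_] := Hs n; apply.
  + by move=> n i _; have [+ _] := Hs n; apply.
  suff <- : z = x by exists t.
  apply/eqP; rewrite -subr_eq0 -normr_eq0; apply/eqP/le_anti.
  rewrite normr_ge0 andbT distrC; apply/ler_addgt0Pr => e e0; rewrite add0r.
  apply: (zlim (closed_ball_ Num.Def.normr x e)); first exact: closed_closed_ball_.
  have [N _ HN] := near_infty_natSinv_lt (PosNum e0).
  exists N => n Nn; rewrite /closed_ball_ /=.
  by apply: ltW; apply: lt_trans (Hy n).2 _; exact: (HN n).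
- move=> U oU KU; apply: contrapT => nU.
  have /choice[x Hx] : forall n, exists x, B (S n) x /\ ~ U x.
    move=> n; apply: contrapT => /forallNP H; apply: nU.
    apply: (lt_le_trans (cS n)); apply: c_mono => x Bx.
    by apply: contrapT => nUx; apply: (H x).
  have /choice[s Hs] : forall n, exists s, (forall i, (i < n)%N ->
      (s i <= h i)%N) /\ forall l, F l s (x n).
    move=> n; have [[s [Hs Fs]] _] := Hx n; exists s; split=> // i ni.
    by have := Hs i; rewrite sS nS//; apply.
  have [|||z [t [Dz th Ft zlim]]] := @scheme_limit F D h x s sF cD.
  + by move=> n; apply: AD; rewrite AE; exists (s n); have [] := Hs n.
  + by move=> n l; have [_] := Hs n; apply.
  + by move=> n i ni; have [+ _] := Hs n; apply.
  have : (~` U) z.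
    apply: zlim; first exact: open_closedC.
    by exists 0%N => n _; have [] := Hx n.
  by apply; apply: KU; exists t.
Qed.

End Souslin.

Section RowTopology.
Context {R : realType}.
Implicit Types (k n m : nat).

Lemma ball_coord m (x y : 'rV[R]_m) e a : ball x e y -> `|x 0 a - y 0 a| < e.
Proof. by move=> [_ /(_ 0 a)]. Qed.

Lemma lsubmx_continuous k n : continuous (@lsubmx R 1 k n).
Proof.
move=> x A /nbhs_ballP[e /= e0 eA]; apply/nbhs_ballP; exists e => //= y [_ xy].
by apply: eA; split=> // i j; rewrite !mxE; exact: xy.
Qed.

Lemma rsubmx_continuous k n : continuous (@rsubmx R 1 k n).
Proof.
move=> x A /nbhs_ballP[e /= e0 eA]; apply/nbhs_ballP; exists e => //= y [_ xy].
by apply: eA; split=> // i j; rewrite !mxE; exact: xy.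
Qed.

(** An open enlargement that stays within the 3^m neighbours; it replaces the half-open cube
    wherever openness or compactness enters. *)
Definition ocube m (c : cubeidx m) : set 'rV[R]_m :=
  \bigcup_(y in cube c) ball y (2 ^+ c.1)^-1.

Lemma open_ocube m (c : cubeidx m) : open (ocube c).
Proof. by apply: bigcup_open => y _; exact: ball_open. Qed.

Lemma cube_ocube m (c : cubeidx m) : cube c `<=` ocube c.
Proof.
by move=> y cy; exists y => //; apply: ballxx; rewrite invr_gt0 exprn_gt0.
Qed.

Lemma ocube_nbr m (c : cubeidx m) x : ocube c x ->
  exists e, cube (c.1, nbr (N := 1) c.2 e) x.
Proof.
move=> [y cy yx]; have [|e He] := @fidx_nbr R m 1 c.1 y x.
  move=> a; rewrite -ler_pdivlMl ?exprn_gt0// mulr1.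
  exact/ltW/ball_coord.
by exists e; rewrite /cube/= He cy.
Qed.

Lemma cube_subset_ball m (x : 'rV[R]_m) (e : R) : 0 < e ->
  exists j, cube (j, fidx j x) `<=` ball x e.
Proof.
move=> e0; have [j je] := @pw_small R 1 e ltr01 e0.
exists j => y; rewrite /cube/= => E; split=> // i a; rewrite ord1.
apply: le_lt_trans je; rewrite pw1E.
exact: fidx_dist.
Qed.

Lemma mbl_open m (U : set 'rV[R]_m) : open U -> (@lam R m).-caratheodory U.
Proof.
move=> oU.
have -> : U = \bigcup_(c in [set c | @cube R m c `<=` U]) cube c.
  apply/seteqP; split=> [x Ux|x [c]]; last exact.
  have /nbhs_ballP[e /= e0 eU] : nbhs x U by exact: open_nbhs_nbhs.
  have [j jx] := cube_subset_ball x e0.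
  by exists (j, fidx j x) => //; exact: subset_trans eU.
by apply: mbl_bigcup => c _; exact: measurable_cube.
Qed.

(** Closed on all sides, unlike a cube of level 0, so as to be compact. *)
Definition unitbox m (z : 'rV[int]_m) : set 'rV[R]_m :=
  [set x | forall a, (z 0 a)%:~R <= x 0 a <= (z 0 a)%:~R + 1].

Lemma compact_unitbox m (z : 'rV[int]_m) : compact (unitbox z).
Proof.
have := @rV_compact R m (fun a => `[(z 0 a)%:~R, (z 0 a)%:~R + 1]%classic).
move=> /(_ (fun a => @segment_compact _ _ _)); congr compact.
Qed.

Lemma unitbox_floor m (x : 'rV[R]_m) : unitbox (fidx 0 x) x.
Proof.
move=> a; rewrite !mxE expr0 mul1r.
by have /andP[-> /ltW] := floor_itv (x 0 a); rewrite intrD.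
Qed.

End RowTopology.

(** * From Borel sets to compact sets of positive capacity *)

Section RegularCapacity.
Context {R : realType} {k n : nat}.
Variable s : R.
Local Open Scope ereal_scope.
Local Notation lam := (@lam R k).
Local Notation mbl := (lam.-caratheodory).
Local Notation cap := (@cap R k n s).
Implicit Types (A B K : set 'rV[R]_(k + n)).

Lemma cap_null_subset A B : A `<=` B -> cap B = 0 -> cap A = 0.
Proof. by apply: content_null_subset => p; rewrite mulr_ge0 ?pw_ge0. Qed.

(** Enlarging the cubes costs a constant factor, which is harmless for null sets. This is enough to
    turn the conclusion of [capacitability] into [cap K <> 0]. *)
Lemma cap_open0 A (e : R) : cap A = 0 -> (0 < e)%R ->
  exists U, [/\ open U, A `<=` U & cap U <= e%:E].
Proof.
have w0 (p : cubeidx k * cubeidx n) : (0 <= pw k%:R p.1.1 * pw s p.2.1 :> R)%R.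
  by rewrite mulr_ge0 ?pw_ge0.
move=> A0 e0; pose nb := ({ffun 'I_k -> 'I_(1 + 1).+1} * {ffun 'I_n -> 'I_(1 + 1).+1})%type.
pose C := #|{: nb}|%:R : R.
have C0 : (0 < C)%R.
  by rewrite /C ltr0n card_prod !card_ffun !card_ord muln_gt0 !expn_gt0.
have [U [_ UA Ue]] := (content_eq0 setT (@prodcube R k n) w0 A).1 A0 (e / C)%R (divr_gt0 e0 C0).
pose V (p : cubeidx k * cubeidx n) : set 'rV[R]_(k + n) :=
  [set x | ocube p.1 (lsubmx x) /\ ocube p.2 (rsubmx x)].
exists (\bigcup_(p in U) V p); split.
- apply: bigcup_open => p _; apply: openI.
    by apply: open_comp => [x _|]; [exact: lsubmx_continuous|exact: open_ocube].
  by apply: open_comp => [x _|]; [exact: rsubmx_continuous|exact: open_ocube].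
- move=> x /UA[p Up [p1 p2]]; exists p => //.
  by split; exact: cube_ocube.
pose g (q : (cubeidx k * cubeidx n) * nb) : cubeidx k * cubeidx n :=
  ((q.1.1.1, nbr q.1.1.2 q.2.1), (q.1.2.1, nbr q.1.2.2 q.2.2)).
apply: (@le_trans _ _ (\esum_(q in g @` (U `*` setT)) (pw k%:R q.1.1 * pw s q.2.1)%:E)).
  apply: content_le => // x [p Up [/ocube_nbr[e1 H1] /ocube_nbr[e2 H2]]].
  by exists (g (p, (e1, e2))) => //; exists (p, (e1, e2)).
apply: le_trans (esum_fibers U (v := fun p => (pw k%:R p.1.1 * pw s p.2.1)%R)
  (w := fun p => (pw k%:R p.1.1 * pw s p.2.1)%R) w0 _) _ => //.
apply: (@le_trans _ _ (C%:E * (e / C)%:E)).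
  by apply: lee_wpmul2l => //; rewrite lee_fin ltW.
by rewrite -EFinM lee_fin mulrC divfK// gt_eqF.
Qed.

Lemma cap_borel_compact B : borel_set B -> cap B <> 0 -> exists z K,
  [/\ compact K, K `<=` B, K `<=` unitbox z & cap K <> 0].
Proof.
move=> bB B0.
have [z Bz] : exists z : 'rV[int]_(k + n), cap (B `&` unitbox z) <> 0.
  apply: contrapT => /forallNP H; apply: B0.
  apply: (@cap_null_subset _ (\bigcup_(z in setT) (B `&` unitbox z))).
    by move=> x Bx; exists (fidx 0 x) => //; split=> //; exact: unitbox_floor.
  by apply: cap_bigcup0 => z _; apply: contrapT; exact: H.
have [a a0 aB] : exists2 a : R, (0 < a)%R & a%:E < cap (B `&` unitbox z).
  move: Bz (cap_ge0 s (B `&` unitbox z)); case: (cap _) => [r|_ _|//].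
    move=> r0; rewrite lee_fin => r1; have rp : (0 < r)%R.
      by rewrite lt_neqAle r1 andbT; apply/eqP => r0'; apply: r0; rewrite -r0'.
    by exists (r / 2)%R; rewrite ?divr_gt0// lte_fin; lra.
  by exists 1%R => //; exact: ltry.
have sBz : souslin (B `&` unitbox z).
  apply: souslin_setI; first exact: borel_souslin.
  apply: souslin_closed; apply: compact_closed; last exact: compact_unitbox.
  exact: norm_hausdorff.
have [|||K [cK KB KU]] := @capacitability R _ cap (unitbox z) _ a _ _ (@compact_unitbox R _ z) _ sBz aB.
- by move=> A A' AA'; exact: cap_subset.
- by move=> A incA Aa; exact: cap_nondecreasing_bigcup.
- by move=> x [].
exists z, K; split=> // [x /KB[]//|x /KB[]//|K0].
have [U [oU KsU Ua]] := cap_open0 K0 a0.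
by have := KU U oU KsU; rewrite ltNge Ua.
Qed.

End RegularCapacity.

(** * Compact sets with null slices *)

Section CompactNull.
Context {R : realType} {k n : nat}.
Local Open Scope ereal_scope.
Local Notation lam := (@lam R k).
Local Notation mbl := (lam.-caratheodory).
Implicit Types (s : R) (K : set 'rV[R]_(k + n)).

Lemma esum_lam_le (I : countType) (J : set I) (D : I -> set 'rV[R]_k) B :
  (forall i, J i -> mbl (D i)) -> trivIset J D ->
  (forall i, J i -> D i `<=` B) -> \esum_(i in J) lam (D i) <= lam B.
Proof.
move=> mD tD DB; apply: ge_ereal_sup => _ [X [finX XJ] <-].
have mX : mbl (\bigcup_(i in X) D i) by apply: mbl_bigcup => i /XJ; exact: mD.
have E := @content_fin_bigcup _ _ _ (@lam_measure R k) I X D finX.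
rewrite -[X in X <= _]E //.
- by apply: le_lam => x [i /XJ Ji]; exact: DB.
- by apply: sub_trivIset tD.
- by move=> i /XJ; exact: mD.
Qed.

Lemma lam_unitbox (z : 'rV[int]_k) :
  lam (unitbox z) <= (#|{ffun 'I_k -> 'I_(1 + 1).+1}|%:R)%:E.
Proof.
pose x0 : 'rV[R]_k := \row_a (z 0%R a)%:~R.
have f0 : fidx 0 x0 = z.
  by apply/rowP => a; rewrite !mxE expr0 mul1r intrKfloor.
apply: (@le_trans _ _ (lam (\bigcup_(e in setT) cube (0%N, nbr (N := 1) z e)))).
  apply: le_lam => x bx; have [|e He] := @fidx_nbr R k 1 0 x0 x.
    by move=> a; rewrite expr0 mul1r mxE; have := bx a; rewrite ler_norml; lra.
  by exists e => //; rewrite /cube/= He f0.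
apply: (le_trans (dcont_bigcup _ _ _)).
rewrite -[X in _ <= X%:E]mulr1; apply: esum_fin => // e; first exact: lam_ge0.
by apply: (le_trans (dcont_cube _ _)); rewrite pw0.
Qed.

(* Tube lemma: a finite family of cubes covering the slice of a compact set over
   [t] also covers the slices over all nearby points. *)
Lemma open_slice_subset K (V : set 'rV[R]_n) : compact K -> open V ->
  open [set t | slice K t `<=` V].
Proof.
move=> cK oV; rewrite -[X in open X]setCK; apply: closed_openC.
have -> : ~` [set t | slice K t `<=` V] =
    @lsubmx R 1 k n @` (K `&` @rsubmx R 1 k n @^-1` (~` V)).
  apply/seteqP; split=> [t /existsNP[y /not_implyP[Ky nVy]]|_ [x [Kx nVx] <-] sub].
    by exists (row_mx t y); [split=> //=; rewrite row_mxKr|rewrite row_mxKl].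
  by apply: nVx; apply: sub; rewrite /slice/= hsubmxK.
apply: compact_closed; first exact: norm_hausdorff.
apply: continuous_compact; first exact/continuous_subspaceT/lsubmx_continuous.
apply: (subclosed_compact _ cK) => [|x []//].
apply: closedI; first by apply: compact_closed => //; exact: norm_hausdorff.
apply: closed_comp => [x _|]; [exact: rsubmx_continuous|exact: open_closedC].
Qed.

Lemma compact_slice K t : compact K -> compact (slice K t).
Proof.
move=> cK.
have -> : slice K t = @rsubmx R 1 k n @` (K `&` @lsubmx R 1 k n @^-1` [set t]).
  apply/seteqP; split=> [y Ky|_ [x [Kx xt] <-]].
    by exists (row_mx t y); [split=> //=; rewrite row_mxKl|rewrite row_mxKr].
  by rewrite /slice/= -xt hsubmxK.
apply: continuous_compact; first exact/continuous_subspaceT/rsubmx_continuous.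
apply: (subclosed_compact _ cK) => [|x []//].
apply: closedI; first by apply: compact_closed => //; exact: norm_hausdorff.
apply: closed_comp => [x _|]; first exact: lsubmx_continuous.
by apply: compact_closed; [exact: norm_hausdorff|exact: compact_set1].
Qed.

(** Finite lists [v] of cubes of small total weight are countably many, so taking the first one in
    the enumeration that covers the slice over [t] is a measurable choice; [D v] is where [v] is
    taken. Compactness of [K] gives both the finiteness of the lists and the openness of [O v]. *)
Lemma cap_compact0 s K (z : 'rV[int]_(k + n)) (N : set 'rV[R]_k) :
  compact K -> K `<=` unitbox z -> lam N = 0 ->
  (forall t, ~ N t -> dcont s (slice K t) = 0) -> cap s K = 0.
Proof.
move=> cK Kz N0 K0; pose bx := unitbox (lsubmx z) : set 'rV[R]_k.
pose C := #|{ffun 'I_n -> 'I_(1 + 1).+1}|%:R : R.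
pose M := #|{ffun 'I_k -> 'I_(1 + 1).+1}|%:R : R.
have C0 : (0 <= C)%R by rewrite /C.
have M0 : (0 <= M)%R by rewrite /M.
apply/eqP; rewrite eq_le cap_ge0 andbT; apply/lee_addgt0Pr => e e0; rewrite add0e.
pose e' := (e / (C * M + 1))%R.
have CM0 : (0 < C * M + 1)%R by rewrite ltr_wpDl// mulr_ge0.
have e'0 : (0 < e')%R by rewrite divr_gt0.
pose V (v : seq (cubeidx n)) := \bigcup_(c in [set` v]) @ocube R n c.
pose G := [set v : seq (cubeidx n) | \esum_(c in [set` v]) (pw s c.1)%:E <= e'%:E].
pose O v := [set t | slice K t `<=` V v].
have oO v : open (O v).
  by apply: open_slice_subset => //; apply: bigcup_open => c _; exact: open_ocube.
pose D v := bx `&` (O v `\` \bigcup_(v' in [set v' | G v' /\ (pickle v' < pickle v)%N]) O v').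
have mbx : mbl bx.
  rewrite -(setCK bx); apply: mblC; apply: mbl_open; apply: closed_openC.
  by apply: compact_closed; [exact: norm_hausdorff|exact: compact_unitbox].
have mD v : mbl (D v).
  apply: mblI => //; apply: mblD; first exact: mbl_open.
  by apply: mbl_bigcup => v' _; exact: mbl_open.
have tD : trivIset G D.
  move=> v v' Gv Gv' [t [[_ [Ov nv]] [_ [Ov' nv']]]].
  have pI : injective (fun v : seq (cubeidx n) => pickle v).
    exact: (pcan_inj (@pickleK _)).
  have [lt|gt|/pI//] := ltngtP (pickle v) (pickle v').
  - by case: nv'; exists v.
  - by case: nv; exists v'.
have covD t : bx t -> ~ N t -> exists2 v, G v & D v t.
  move=> bt nN.
  have [U [UK Ue]] := (dcont_eq0 _ _).1 (K0 t nN) e' e'0.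
  have := @compact_slice K t cK; rewrite compact_cover => /(_ _ U (@ocube R n)).
  case=> [c _|y /UK[c Uc cy]|F FU KF]; first exact: open_ocube.
    by exists c => //; exact: cube_ocube.
  have GF : G (finmap.enum_fset F).
    apply: le_trans Ue; apply: esum_subset => [c /= cF|c].
      by have := FU c cF; rewrite inE.
    by rewrite lee_fin pw_ge0.
  pose P l := `[< exists v, [/\ pickle v = l, G v & O v t] >].
  have exP : exists l, P l.
    by exists (pickle (finmap.enum_fset F)); apply/asboolP; exists (finmap.enum_fset F).
  case: (ex_minnP exP) => l /asboolP[v [vl Gv Ov]] lmin.
  exists v => //; split=> //; split=> // -[v' [Gv' lt] Ov'].
  have /lmin : P (pickle v') by apply/asboolP; exists v'.
  by rewrite leqNgt -vl lt.
pose A v := K `&` [set x | D v (lsubmx x)].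
pose KN := K `&` [set x | N (lsubmx x)].
have KA : K `<=` KN `|` \bigcup_(v in G) A v.
  move=> x Kx; have [Nx|nNx] := pselect (N (lsubmx x)); [by left|right].
  have [|v Gv Dv] := covD (lsubmx x) _ nNx; last by exists v.
  by move=> a; have := Kz x Kx (lshift n a); rewrite !mxE.
have capA v : G v -> cap s (A v) <= (C * e')%:E * lam (D v).
  move=> Gv.
  have fD : lam (D v) \is a fin_num.
    rewrite ge0_fin_numE ?lam_ge0//.
    apply: (@le_lt_trans _ _ (lam bx)); first by apply: le_lam => t [].
    by apply: (le_lt_trans (lam_unitbox _)); rewrite ltry.
  pose r := fine (lam (D v)); have rE : lam (D v) = r%:E by rewrite fineK.
  have r0 : (0 <= r)%R by rewrite -lee_fin -rE lam_ge0.
  pose T (p : cubeidx n * {ffun 'I_n -> 'I_(1 + 1).+1}) := [set x : 'rV[R]_(k + n) |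
    D v (lsubmx x) /\ cube (p.1.1, nbr p.1.2 p.2) (rsubmx x)].
  apply: (@le_trans _ _ (cap s (\bigcup_(p in [set` v] `*`` fun=> setT) T p))).
    apply: cap_subset => x [Kx Dx]; have [_ [Ov _]] := Dx.
    have [|c vc /ocube_nbr[ee Hee]] := Ov (rsubmx x); first by rewrite /slice/= hsubmxK.
    by exists (c, ee).
  apply: (le_trans (cap_bigcup _ _ _)).
  apply: (@le_trans _ _ (\esum_(p in [set` v] `*`` fun=> setT) (pw s p.1.1 * r)%:E)).
    by apply: le_esum => p _; rewrite EFinM -rE; exact: cap_rect.
  rewrite -(esum_esum (a := fun c ee => (pw s c.1 * r)%:E)); last first.
    by move=> *; rewrite lee_fin mulr_ge0 ?pw_ge0.
  apply: (@le_trans _ _ (\esum_(c in [set` v]) ((C * r)%:E * (pw s c.1)%:E))).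
    apply: le_esum => c _; apply: (@le_trans _ _ (C * (pw s c.1 * r))%:E).
      by apply: esum_fin => // *; rewrite ?lee_fin mulr_ge0 ?pw_ge0.
    by rewrite -EFinM lee_fin; lra.
  rewrite esum_cmul ?mulr_ge0//; last by move=> c; rewrite lee_fin pw_ge0.
  apply: (@le_trans _ _ ((C * r)%:E * e'%:E)).
    by apply: lee_wpmul2l => //; rewrite lee_fin mulr_ge0.
  by rewrite rE -!EFinM lee_fin; lra.
apply: (@le_trans _ _ (cap s KN + cap s (\bigcup_(v in G) A v))).
  apply: (le_trans (cap_subset s KA)); apply: content_setU.
  by move=> p; rewrite mulr_ge0 ?pw_ge0.
(* Over the null set [N] all cubes may be used at no cost. *)
have -> : cap s KN = 0.
  apply/eqP; rewrite eq_le cap_ge0 andbT.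
  apply: (@le_trans _ _ (cost s (fun Q : cubeidx n => N))).
    by apply: cap_le_cost => x [_ Nx]; exists (0%N, fidx 0 (rsubmx x)).
  by rewrite /cost esum1// => Q _; rewrite N0 mule0.
rewrite add0e; apply: (le_trans (cap_bigcup _ _ _)).
apply: (@le_trans _ _ (\esum_(v in G) ((C * e')%:E * lam (D v)))).
  exact: le_esum.
rewrite esum_cmul; [|by rewrite mulr_ge0// ltW|by move=> v; exact: lam_ge0].
apply: (@le_trans _ _ ((C * e')%:E * M%:E)).
  apply: lee_wpmul2l; first by rewrite lee_fin mulr_ge0// ltW.
  apply: (@le_trans _ _ (lam bx)); last exact: lam_unitbox.
  by apply: esum_lam_le => // v _ t [].
rewrite -EFinM lee_fin; have : (e' * (C * M + 1) = e)%R by rewrite divfK// gt_eqF.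
move: e'0; rewrite -lte_fin lte_fin; clearbody e'; lra.
Qed.

End CompactNull.

(** * Sets of capacity zero and their slices *)

Section FamilyLimsup.
Context {R : realType} {k n : nat}.
Variable s : R.
Local Open Scope ereal_scope.
Local Notation lam := (@lam R k).
Local Notation mbl := (lam.-caratheodory).
Local Notation fam := (cubeidx n -> set 'rV[R]_k).
Local Notation U := (caratheodory_type (@lam_outer R k)).

Let term (T : fam) (l : nat) (t : U) : \bar R :=
  if pickle_inv l is Some Q then (pw s Q.1)%:E * (\1_(T Q) t)%:E else 0.

Let term_ge0 T l t : 0 <= term T l t.
Proof.
rewrite /term; case: pickle_inv => // Q.
by rewrite -EFinM lee_fin mulr_ge0 ?pw_ge0.
Qed.

Let fibre_sum (T : fam) (t : U) : \bar R := \sum_(0 <= l <oo) term T l t.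

Let fibre_sum_ge0 T t : 0 <= fibre_sum T t.
Proof. exact: nneseries_ge0. Qed.

Let measurable_term T : (forall Q, mbl (T Q)) ->
  forall l, measurable_fun setT (term T l).
Proof.
move=> mT l; rewrite /term; case: pickle_inv => [Q|]; last exact: measurable_cst.
apply: measurable_funeM; apply/measurable_EFinP.
by apply: measurable_indic; exact: mT.
Qed.

Let measurable_fibre_sum T : (forall Q, mbl (T Q)) ->
  measurable_fun setT (fibre_sum T).
Proof.
move=> mT; apply: ge0_emeasurable_sum => [l t _ _|l _]; first exact: term_ge0.
exact: measurable_term.
Qed.

Let integral_fibre_sum T : (forall Q, mbl (T Q)) ->
  \int[@lam_measure R k]_t fibre_sum T t = cost s T.
Proof.
move=> mT.
have E := @integral_nneseries _ _ _ (@lam_measure R k) setT measurableT (term T)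
  (measurable_term mT) (fun l t _ => term_ge0 T l t).
rewrite /fibre_sum E {E}.
rewrite /cost -(nneseries_pickle (f := fun Q => (pw s Q.1)%:E * lam (T Q))); last first.
  by move=> Q; rewrite mule_ge0 ?lam_ge0// lee_fin pw_ge0.
apply: eq_eseriesr => l _; rewrite /term; case: pickle_inv => [Q|]; last first.
  exact: integral0.
rewrite (ge0_integralZl_EFin _ measurableT); last 3 first.
- by move=> t _; rewrite lee_fin.
- by apply/measurable_EFinP; apply: measurable_indic; exact: mT.
- exact: pw_ge0.
congr (_ * _); rewrite integral_indic// ?setIT//; exact: mT.
Qed.

Let esum_fibre (T : fam) t :
  \esum_(Q in [set Q | T Q t]) (pw s Q.1)%:E <= fibre_sum T t.
Proof.
pose f (Q : cubeidx n) : \bar R := (pw s Q.1)%:E * (\1_(T Q) t)%:E.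
have -> : fibre_sum T t = \esum_(Q in setT) f Q.
  by rewrite -(nneseries_pickle (f := f))// => Q; rewrite /f -EFinM lee_fin mulr_ge0 ?pw_ge0.
rewrite esum_mkcond; apply: le_esum => Q _; rewrite /f indicE.
case: ifPn => [/set_mem TQ|_]; first by rewrite mem_set// mule1.
by rewrite -EFinM lee_fin mulr_ge0 ?pw_ge0.
Qed.

(** With summable costs the series of the fibre sums has finite integral, so outside a null set it
    converges and has arbitrarily small terms. *)
Lemma cap0_families A : cap s A = 0 -> exists (T : nat -> fam) (N : set 'rV[R]_k),
  [/\ forall i Q, mbl (T i Q), forall i, A `<=` famset (T i),
    \esum_(i in setT) cost s (T i) <= 1, lam N = 0 &
    forall t, ~ N t -> forall e : R, (0 < e)%R ->
      exists i, \esum_(Q in [set Q | T i Q t]) (pw s Q.1)%:E <= e%:E].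
Proof.
move=> A0.
have /choice[T HT] : forall i : nat, exists T : fam, [/\ forall Q, mbl (T Q),
    A `<=` famset T & cost s T < (1 / 2 ^+ i.+1)%:E].
  move=> i; apply: cap_family; rewrite A0 lte_fin divr_gt0// exprn_gt0//.
have mT i Q : mbl (T i Q) by have [] := HT i.
have cost1 : \esum_(i in setT) cost s (T i) <= 1.
  apply: (@le_trans _ _ (\esum_(i in [set: nat]) (1 / 2 ^+ (pickle i).+1)%:E)).
    by apply: le_esum => i _; have [_ _ /ltW] := HT i.
  by apply: esum_eps.
pose h (t : U) := \sum_(0 <= i <oo) fibre_sum (T i) t.
have h0 t : 0 <= h t by exact: nneseries_ge0.
have mh : measurable_fun setT h.
  apply: ge0_emeasurable_sum => [i t _ _|i _]; first exact: fibre_sum_ge0.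
  exact: measurable_fibre_sum.
have ih : \int[@lam_measure R k]_t h t <= 1.
  have E := @integral_nneseries _ _ _ (@lam_measure R k) setT measurableT
    (fun i => fibre_sum (T i)) (fun i => measurable_fibre_sum (mT i))
    (fun i t _ => fibre_sum_ge0 (T i) t).
  rewrite /h E {E}.
  rewrite nneseries_esumT; last by move=> i; exact: integral_ge0.
  apply: le_trans cost1; apply: le_esum => i _.
  by rewrite (integral_fibre_sum (mT i)).
have [] : (@lam_measure R k).-integrable setT h.
  by apply/integrableP; split=> //; under eq_integral do rewrite gee0_abs//;
    apply: le_lt_trans ih _; rewrite ltry.
move=> /integrable_ae => /(_ measurableT) [N [mN N0 subN]].
exists T, N; split=> //; first by move=> i; have [] := HT i.
move=> t nN e e0.
have fh : h t \is a fin_num.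
  by apply: contrapT => nf; apply: nN; apply: subN => /= /(_ I).
apply: contrapT => /forallNP H.
have big i : e%:E <= fibre_sum (T i) t.
  apply: le_trans (esum_fibre _ _); rewrite leNgt; apply/negP => /ltW; exact: H.
pose m := (Num.bound (fine (h t) / e)).
have : (m%:R * e)%:E <= h t.
  apply: le_trans (@nneseries_lim_ge _ _ xpredT 0 m _); last by [].
  apply: (@le_trans _ _ (\sum_(0 <= i < m) e%:E)); last exact: lee_sum.
  by rewrite big_mkord sumEFin sumr_const card_ord mulr_natl.
rewrite -(fineK fh) lee_fin -ler_pdivlMr//; apply/negP; rewrite -ltNge.
apply: archi_boundP; apply: divr_ge0 (ltW e0); exact: fine_ge0.
Qed.

(** The fibres of families of small cost are covers of the slices. In contrapositive form this
    yields positive [cap] for exponents below the essential supremum. *)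
Lemma cap0_slice (A : set 'rV[R]_(k + n)) : cap s A = 0 -> exists2 N : set 'rV[R]_k, lam N = 0 &
  forall t, ~ N t -> dcont s (slice A t) = 0.
Proof.
move=> /cap0_families[T [N [_ AT _ N0 small]]]; exists N => // t nN.
apply/dcont_eq0 => e e0; have [i Hi] := small t nN e e0.
exists [set Q | T i Q t]; split=> // y /(AT i)[Q].
by rewrite row_mxKl row_mxKr => TQ Qy; exists Q.
Qed.

(** The union of the families covers almost every fibre at arbitrarily fine scales: a cover of total
    weight at most [pw s J] has only cubes of level at least [J], and such covers occur for every
    [J]. *)
Lemma cap0_limsup A : (0 < s)%R -> cap s A = 0 ->
  exists (T : fam) (N : set 'rV[R]_k), [/\ forall Q, mbl (T Q),
    cost s T <= 1, lam N = 0 &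
    forall x, A x -> ~ N (lsubmx x) -> forall J, exists Q, [/\ (J <= Q.1)%N,
      T Q (lsubmx x) & @cube R n Q (rsubmx x)]].
Proof.
move=> s0 /cap0_families[T [N [mT AT cT N0 small]]].
exists (fun Q => \bigcup_i T i Q), N; split=> //.
- by move=> Q; apply: mbl_bigcup.
- apply: le_trans cT; rewrite /cost esum_swap; last first.
    by move=> i Q; rewrite mule_ge0 ?lam_ge0// lee_fin pw_ge0.
  apply: le_esum => Q _; rewrite esum_cmul ?pw_ge0//; last by move=> i; exact: lam_ge0.
  apply: lee_wpmul2l; first by rewrite lee_fin pw_ge0.
  exact: dcont_bigcup.
- move=> x Ax nN J; have [i Hi] := small _ nN (pw s J) (pw_gt0 _ _).
  have [Q TQ Qx] := AT i x Ax; exists Q; split=> //; last by exists i.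
  apply: (@pw_leq R s) => //; rewrite -lee_fin; apply: le_trans Hi.
  rewrite -(@esum_set1 _ _ Q (fun Q => (pw s Q.1)%:E))//; last by rewrite lee_fin pw_ge0.
  by apply: esum_subset => [_ ->//|Q']; rewrite lee_fin pw_ge0.
Qed.

Lemma fidx_lsubmx m1 m2 j (x : 'rV[R]_(m1 + m2)) :
  fidx j (lsubmx x) = lsubmx (fidx j x).
Proof. by apply/rowP => a; rewrite !mxE. Qed.

Lemma fidx_rsubmx m1 m2 j (x : 'rV[R]_(m1 + m2)) :
  fidx j (rsubmx x) = rsubmx (fidx j x).
Proof. by apply/rowP => a; rewrite !mxE. Qed.

(** A cube of R^(k+n) is a product of two cubes of equal level. There is no converse: everything
    over a null set of R^k has [cap] zero, even if that null set has dimension [k]. *)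
Lemma dcont0_cap0 (A : set 'rV[R]_(k + n)) : dcont (k%:R + s)%R A = 0 -> cap s A = 0.
Proof.
move=> /dcont_eq0 H; apply/content_eq0 => [p|e /H[V [VA Ve]]].
  by rewrite mulr_ge0 ?pw_ge0.
pose g (c : cubeidx (k + n)) : cubeidx k * cubeidx n :=
  ((c.1, lsubmx c.2), (c.1, rsubmx c.2)).
exists (g @` V); split=> //.
  move=> x /VA[c Vc cx]; exists (g c); first by exists c.
  by rewrite /prodcube /cube /= fidx_lsubmx fidx_rsubmx cx.
apply: le_trans Ve; apply: (esum_le_cover (e := g)) => // c.
  by rewrite lee_fin pw_ge0.
by rewrite lee_fin pwD.
Qed.

End FamilyLimsup.

(** * Density points of the covers *)

Section LipschitzGraphs.
Context {R : realType} {k n : nat}.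
Local Open Scope ereal_scope.
Implicit Types (P A : set 'rV[R]_(k + n)).

(** The integer constant makes the piece of the graph over a cube of R^k lie in the [nbr] cubes,
    with [N := M], of any cube of the same level that this piece meets. *)
Definition lipgraph (M : nat) P := forall x y (d : R), P x -> P y ->
  (forall b, `|lsubmx x 0%R b - lsubmx y 0%R b| <= d)%R ->
  forall a, (`|x 0%R a - y 0%R a| <= M%:R * d)%R.

Lemma lipgraph_nbr M P j x y : lipgraph M P -> P x -> P y ->
  fidx j (lsubmx x) = fidx j (lsubmx y) ->
  exists e, fidx j y = nbr (N := M) (fidx j x) e.
Proof.
move=> PM Px Py E; apply: fidx_nbr => a.
rewrite -ler_pdivlMl ?exprn_gt0// mulrC; apply: PM => // b.
exact: fidx_dist.
Qed.

Lemma lipgraph_null M P A s : lipgraph M P -> A `<=` P ->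
  dcont s (@lsubmx R 1 k n @` A) = 0 -> dcont s A = 0.
Proof.
move=> PM AP /dcont_eq0 H; apply/dcont_eq0 => e e0.
pose C := #|{ffun 'I_(k + n) -> 'I_(M + M).+1}|%:R : R.
have C0 : (0 < C)%R by rewrite ltr0n card_ffun !card_ord expn_gt0.
have [U [UA Ue]] := H (e / C)%R (divr_gt0 e0 C0).
have /choice[r Hr] : forall c : cubeidx k, exists x : 'rV[R]_(k + n),
    (exists2 y, A y & cube c (lsubmx y)) -> A x /\ cube c (lsubmx x).
  move=> c; have [[y Ay cy]|] := pselect (exists2 y, A y & cube c (lsubmx y)).
    by exists y.
  by exists 0%R.
pose g (p : cubeidx k * {ffun 'I_(k + n) -> 'I_(M + M).+1}) : cubeidx (k + n) :=
  (p.1.1, nbr (fidx p.1.1 (r p.1)) p.2).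
exists (g @` (U `*` setT)); split.
  move=> x Ax; have [|c Uc cx] := UA (lsubmx x); first by exists x.
  have [Ar cr] := Hr c (ex_intro2 _ _ x Ax cx).
  have [|ee Hee] := @lipgraph_nbr M P c.1 (r c) x PM (AP _ Ar) (AP _ Ax).
    by rewrite /cube/= in cr cx; rewrite cr cx.
  by exists (g (c, ee)) => //; exists (c, ee).
apply: le_trans (esum_fibers U (v := fun c => pw s c.1) (w := fun c => pw s c.1) _ _) _ => //.
  by move=> c; exact: pw_ge0.
apply: (@le_trans _ _ (C%:E * (e / C)%:E)).
  by apply: lee_wpmul2l => //; rewrite lee_fin ltW.
by rewrite -EFinM lee_fin mulrC divfK// gt_eqF.
Qed.

Lemma lsubmx_null A s : dcont s A = 0 -> dcont s (@lsubmx R 1 k n @` A) = 0.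
Proof.
move=> /dcont_eq0 H; apply/dcont_eq0 => e /H[U [UA Ue]].
pose g (c : cubeidx (k + n)) : cubeidx k := (c.1, lsubmx c.2).
exists (g @` U); split.
  move=> _ [x /UA[c Uc cx] <-]; exists (g c); first by exists c.
  by rewrite /cube/= fidx_lsubmx cx.
apply: le_trans Ue; apply: (esum_le_cover (e := g)) => // c.
by rewrite lee_fin pw_ge0.
Qed.

End LipschitzGraphs.

Section Density.
Context {R : realType} {k n : nat}.
Variables (s eps : R).
Local Open Scope ereal_scope.
Local Notation lam := (@lam R k).
Local Notation mbl := (lam.-caratheodory).
Local Notation fam := (cubeidx n -> set 'rV[R]_k).
Implicit Types (P B : set 'rV[R]_(k + n)).

Let good (T : fam) j (zI : 'rV[int]_k) (zQ : 'rV[int]_n) :=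
  (pw eps j * pw k%:R j)%:E <= lam (T (j, zQ) `&` cube (j, zI)).

Let dense (T : fam) : set 'rV[R]_(k + n) := [set x | forall J, exists2 j,
  (J <= j)%N & good T j (fidx j (lsubmx x)) (fidx j (rsubmx x))].

(* The volume of a good cube of [R^k] is controlled by the part of the base of
   its partner lying in it, and these parts add up to at most [cost s T]. *)
Let dense_null (T : fam) : (forall Q, mbl (T Q)) -> cost s T <= 1 -> (0 < eps)%R ->
  dcont (k%:R + s + eps + eps)%R (dense T) = 0.
Proof.
move=> mT cT e0; apply/dcont_eq0 => e ep.
(* One [eps] in the exponent pays for the density threshold; the other leaves the factor
   [pw eps J < e] on cubes of level at least [J]. *)
have [J Je] := @pw_small R eps e e0 ep.
exists [set c | (J <= c.1)%N /\ good T c.1 (lsubmx c.2) (rsubmx c.2)]; split.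
  move=> x /(_ J)[j Jj gj]; exists (j, fidx j x) => //=; split=> //.
  by rewrite -fidx_lsubmx -fidx_rsubmx.
set U := [set c | _].
have g0 (c : cubeidx n) (X : set 'rV[R]_k) : 0 <= (pw s c.1)%:E * lam X.
  by rewrite mule_ge0 ?lam_ge0// lee_fin pw_ge0.
pose b (p : cubeidx n * 'rV[int]_k) :=
  (pw s p.1.1)%:E * lam (T p.1 `&` cube (p.1.1, p.2)).
have sum1 : \esum_(p in setT `*`` fun=> setT) b p <= 1.
  rewrite -(esum_esum (a := fun Q z => b (Q, z))); last by move=> *; exact: g0.
  apply: le_trans cT; apply: le_esum => Q _.
  rewrite esum_cmul ?pw_ge0//; last by move=> *; exact: lam_ge0.
  apply: lee_wpmul2l; first by rewrite lee_fin pw_ge0.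
  apply: esum_lam_le => //.
  - by move=> z _; apply: mblI => //; exact: measurable_cube.
  - by move=> z z' _ _ [t [[_ +] [_ +]]]; rewrite /cube/= => -> ->.
apply: (@le_trans _ _ (\esum_(p in setT `*`` fun=> setT) ((pw eps J)%:E * b p))).
  pose h (p : cubeidx n * 'rV[int]_k) : cubeidx (k + n) := (p.1.1, row_mx p.2 p.1.2).
  have W : \esum_(c in U) (pw (k%:R + s + eps + eps) c.1)%:E <=
     \esum_(p in h @^-1` U) ((pw eps J)%:E * b p).
    apply: (esum_le_cover (e := h)).
    - by move=> p; rewrite mule_ge0 ?g0// lee_fin pw_ge0.
    - move=> [j z] Uj; exists ((j, rsubmx z), lsubmx z); last first.
        by rewrite /h /= hsubmxK.
      by rewrite /h /= hsubmxK.
    - move=> [[j zQ] zI] [/= Jj]; rewrite row_mxKl row_mxKr => gj.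
      rewrite pwD EFinM muleC; apply: lee_pmul.
      + by rewrite lee_fin pw_ge0.
      + by rewrite lee_fin pw_ge0.
      + by rewrite lee_fin pw_anti// ltW.
      + rewrite /b /=; apply: le_trans (lee_wpmul2l _ gj); last by rewrite lee_fin pw_ge0.
        by rewrite -EFinM lee_fin !pwD; lra.
  apply: (le_trans W); apply: esum_subset => // p.
  by rewrite mule_ge0 ?g0// lee_fin pw_ge0.
rewrite esum_cmul ?pw_ge0//; last by move=> p; exact: g0.
apply: (@le_trans _ _ ((pw eps J)%:E * 1)).
  by apply: lee_wpmul2l => //; rewrite lee_fin pw_ge0.
by rewrite mule1 lee_fin ltW.
Qed.

Let mul_pw_cvg (C : R) : (0 <= C)%R -> (0 < eps)%R ->
  \sum_(0 <= j <oo) (C * pw eps j)%:E < +oo.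
Proof.
move=> C0 e0; set g : R := (2 `^ (- eps))%R.
have g1 : (g < 1)%R.
  rewrite ltNge; apply/negP => h.
  by have := @pw_leq R eps 1 0 e0; rewrite /pw expr0 expr1 => /(_ h).
have g0 : (0 <= g)%R by exact: powR_ge0.
apply: (@le_lt_trans _ _ (C / (1 - g))%:E); last exact: ltry.
apply: lime_le; first by apply: is_cvg_nneseries => j _ _; rewrite lee_fin mulr_ge0 ?pw_ge0.
apply: nearW => N; rewrite sumEFin lee_fin -mulr_sumr ler_wpM2l//.
rewrite -[leRHS]mul1r ler_pdivlMr ?subr_gt0// big_mkord.
have -> : ((\sum_(i < N) pw eps i) * (1 - g) = 1 - g ^+ N)%R.
  by rewrite -[RHS]opprB subrX1 -mulNr opprB mulrC.
by have := exprn_ge0 N g0; lra.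
Qed.

(** [bad z j] gathers, over the unit cube of index [z], the parts of [T Q] in cubes [I] of level [j]
    where its density is below 2^(-eps j), [Q] running through the level-[j] cubes near the graph
    over [I]. There are 2^(j k) cubes [I] and boundedly many [Q] for each, so the measures are
    summable in [j]. A point of the graph that is covered infinitely often but lies outside
    [dense T] projects into infinitely many bad sets. *)
Let graph_null (T : fam) (N : set 'rV[R]_k) M P : (0 < eps)%R ->
  (forall Q, mbl (T Q)) -> lam N = 0 -> lipgraph M P ->
  (forall x, P x -> ~ N (lsubmx x) -> forall J, exists Q, [/\ (J <= Q.1)%N,
      T Q (lsubmx x) & @cube R n Q (rsubmx x)]) ->
  lam (@lsubmx R 1 k n @` (P `\` dense T)) = 0.
Proof.
move=> e0 mT N0 PM cov.
have /choice[r Hr] : forall c : cubeidx k, exists x : 'rV[R]_(k + n),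
    (exists2 y, P y & cube c (lsubmx y)) -> P x /\ cube c (lsubmx x).
  move=> c; have [[y Ay cy]|] := pselect (exists2 y, P y & cube c (lsubmx y)).
    by exists y.
  by exists 0%R.
pose nb := {ffun 'I_(k + n) -> 'I_(M + M).+1}.
pose part j (zI : 'rV[int]_k) (f : nb) : set 'rV[R]_k :=
  let zQ := rsubmx (nbr (fidx j (r (j, zI))) f) in
  if `[< good T j zI zQ >] then set0 else T (j, zQ) `&` cube (j, zI).
pose bad z j := \bigcup_(p in [set: {ffun 'I_k -> 'I_(2 ^ j)} * nb])
   part j (subidx z p.1) p.2.
have mpart j z f : mbl (part j z f).
  rewrite /part /=; case: asboolP => _; first exact: mbl_set0.
  by apply: mblI => //; exact: measurable_cube.
have mbad z j : mbl (bad z j) by apply: mbl_bigcup.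
have lbad z j : lam (bad z j) <= (#|{: nb}|%:R * pw eps j)%:E.
  apply: (le_trans (dcont_bigcup _ _ _)).
  apply: (@le_trans _ _ (#|{: {ffun 'I_k -> 'I_(2 ^ j)} * nb}|%:R * (pw eps j * pw k%:R j))%:E).
    apply: esum_fin => [|p|p]; first by rewrite mulr_ge0 ?pw_ge0.
      exact: lam_ge0.
    rewrite /part /=; case: asboolP => [_|/negP]; last by rewrite -ltNge => /ltW.
    have -> : dcont k%:R (set0 : set 'rV[R]_k) = 0 := outer_measure0 (@lam_outer R k).
    by rewrite lee_fin mulr_ge0 ?pw_ge0.
  rewrite lee_fin card_prod natrM card_ffun !card_ord !natrX (pw_nat k j).
  have a0 : ((2 ^+ j) ^+ k != 0 :> R)%R by rewrite !expf_neq0.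
  by rewrite le_eqVlt; apply/orP; left; apply/eqP; field.
have lim0 z : lam (lim_sup_set (bad z)) = 0.
  apply: (@lim_sup_set_cvg0 _ _ _ (@lam_measure R k)) => [j|]; first exact: mbad.
  apply: (@le_lt_trans _ _ (\sum_(0 <= j <oo) (#|{: nb}|%:R * pw eps j)%:E)); last exact: mul_pw_cvg.
  by apply: lee_nneseries => [*|*]; [exact: lam_ge0|exact: lbad].
apply: (@dcont_null_subset _ _ _ _ (N `|` \bigcup_(z in setT) lim_sup_set (bad z))); last first.
  by apply: dcont_nullU => //; apply: dcont_bigcup0 => z _; exact: lim0.
move=> _ [x [Px nx] <-]; set t := lsubmx x.
have [Nt|nNt] := pselect (N t); [by left|right].
exists (fidx 0 t) => // J _.
have [J0 HJ0] : exists J0, forall j, (J0 <= j)%N ->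
    ~ good T j (fidx j t) (fidx j (rsubmx x)).
  move/existsNP: nx => [J0 H]; exists J0 => j Jj gj; apply: H.
  by exists j.
have [[j zQ] [/=]] := cov x Px nNt (maxn J J0).
rewrite geq_max => /andP[Jj J0j] TQ Qx; exists j => //.
have [e1 He1] := fidx_subidx 0 j t; rewrite add0n in He1.
have [|Pr cr] := Hr (j, fidx j t); first by exists x.
have [e2 He2] := lipgraph_nbr PM Pr Px cr.
exists (e1, e2) => //=; rewrite /part /= -He1 -He2 -fidx_rsubmx.
case: asboolP => [/HJ0//|_]; last split=> //.
by rewrite /cube/= in Qx; rewrite Qx.
Qed.

(** The order of quantifiers matters: [L] depends on [B] and the exponents, not on [M] or [P]. *)
Lemma density_cover B : (0 < s)%R -> (0 < eps)%R -> cap s B = 0 ->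
  exists L, dcont (k%:R + s + eps + eps)%R L = 0 /\
    forall M P, lipgraph M P -> P `<=` B ->
      dcont k%:R (@lsubmx R 1 k n @` (P `\` L)) = 0.
Proof.
move=> s0 e0 /(cap0_limsup s0)[T [N [mT cT N0 cov]]].
exists (dense T); split; first exact: dense_null.
move=> M P PM PB; apply: graph_null N0 PM _ => // x Px; exact/cov/PB.
Qed.

End Density.

(** * Subsets of intermediate dimension *)

Section CodeSpace.
Context {R : realType} (D : finType) (r : R) (r0 : 0 < r).
Local Open Scope ereal_scope.
Implicit Types (S A : set (nat -> D)) (u v w Q : seq D) (x y : nat -> D).

Definition cyl w : set (nat -> D) := [set x | mkseq x (size w) = w].

(** The content at depth [J] on the tree of words. Positive [ccont 0] together with a bound on
    [ccont J] uniform in [J] ensures dimension exactly [r]. *)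
Definition ccont (J : nat) : set (nat -> D) -> \bar R :=
  content [set w | (J <= size w)%N] cyl (fun w => pw r (size w)).

Let w0 w : (0 <= pw r (size w))%R. Proof. exact: pw_ge0. Qed.

Let w0E w : 0 <= (pw r (size w))%:E. Proof. by rewrite lee_fin. Qed.

Lemma ccont_ge0 J A : 0 <= ccont J A. Proof. exact: content_ge0. Qed.

Lemma mkseq_take x j i : (j <= i)%N -> mkseq x j = take j (mkseq x i).
Proof. by move=> ji; rewrite /mkseq -map_take take_iota (minn_idPl ji). Qed.

Lemma mkseq_agree x y j i : (j <= i)%N -> mkseq x i = mkseq y i ->
  mkseq x j = mkseq y j.
Proof. by move=> ji E; rewrite !(mkseq_take _ ji) E. Qed.

Lemma cyl_agree x y w j : (size w <= j)%N -> mkseq x j = mkseq y j ->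
  cyl w x -> cyl w y.
Proof. by move=> wj E; rewrite /cyl/= -(mkseq_agree wj E). Qed.

Lemma cyl_nested v w x : (size v <= size w)%N -> cyl v x -> cyl w x ->
  cyl w `<=` cyl v.
Proof.
by move=> vw vx wx y wy; apply: cyl_agree vw _ vx; rewrite wx wy.
Qed.

Lemma cyl_eq v w x : size v = size w -> cyl v x -> cyl w x -> v = w.
Proof. by rewrite /cyl/= => E <- <-; rewrite E. Qed.

Lemma cyl_nonempty (d : D) w : cyl w (nth d w).
Proof. exact: mkseq_nth. Qed.

Lemma ccont_le1 A : ccont 0 A <= 1.
Proof.
by have := @content1 R _ _ [set w | (0 <= size w)%N] cyl _ w0 [::] A; apply.
Qed.

Let S0 J (F : {set J.-tuple D}) : set (nat -> D) := [set x | [tuple of mkseq x J] \in F].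

(* [S'] keeps a maximal set of words of a very large length [J'] subject to
   [ccont J (S' & cyl Q) <= pw r (size Q)] for all [Q] of length at most [J].  By
   maximality, whatever is omitted lies in cylinders where this bound is nearly
   attained, so [ccont 0] hardly decreases. *)
Lemma ccont_step S (J : nat) (a : R) : (0 < a)%R -> a%:E < ccont 0 S ->
  exists S', [/\ S' `<=` S, ccont J S' <= 1, a%:E < ccont 0 S' &
    exists J', forall x y, S' x -> S y -> mkseq x J' = mkseq y J' -> S' y].
Proof.
move=> a0 aS.
have fS : ccont 0 S \is a fin_num.
  by rewrite ge0_fin_numE ?ccont_ge0//; apply: le_lt_trans (ccont_le1 S) _; rewrite ltry.
pose m0 := fine (ccont 0 S); have mE : ccont 0 S = m0%:E by rewrite fineK.
have am : (a < m0)%R by rewrite -lte_fin -mE.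
(* [c * a] is the midpoint of [a] and [m0], so a loss by the factor [c > 1] keeps the content above
   [a]. *)
pose c := ((a + m0) / (2 * a))%R.
have ca : (c * a = (a + m0) / 2)%R by rewrite /c; field; rewrite gt_eqF.
have c1 : (1 < c)%R by rewrite ltr_pdivlMr ?mulr_gt0//; lra.
have c0 : (0 < c)%R by lra.
have ci : (0 < 1 - c^-1)%R by rewrite subr_gt0 invf_lt1.
(* One more word of length [J'] weighs less than the fraction [1 - c^-1] of [pw r J]: it can break a
   bound only where that bound was already attained up to the factor [c]. *)
have [J' HJ'] := @pw_small R r _ r0 (mulr_gt0 ci (pw_gt0 r J)).
have JJ' : (J <= J')%N.
  apply/ltnW/(@pw_ltn R r) => //; apply: lt_le_trans HJ' _.
  by rewrite ger_pMl ?pw_gt0// gerBl invr_ge0 ltW.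
pose P (F : {set J'.-tuple D}) := `[< forall Q, (size Q <= J)%N ->
  ccont J (S `&` S0 F `&` cyl Q) <= (pw r (size Q))%:E >].
have P0 : P finset.set0.
  apply/asboolP => Q _; apply: le_trans (w0E Q).
  rewrite (_ : _ `&` _ = set0); last first.
    by apply/seteqP; split=> // x [[_]]; rewrite /S0/= inE.
  by rewrite /ccont content_set0.
have [F /maxsetP[/asboolP PF Fmax] _] := maxset_exists P0.
pose S' := S `&` S0 F.
have S'S : S' `<=` S by move=> x [].
have root : forall x, cyl [::] x by [].
have MS'1 : ccont J S' <= 1.
  have := PF [::] (leq0n _); rewrite pw0; apply: le_trans.
  by apply: content_subset => x S'x; split.
pose sat := [set Q | (size Q <= J)%N /\
  (pw r (size Q))%:E <= c%:E * ccont J (S' `&` cyl Q)].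
have cover x : S x -> ~ S' x -> exists2 Q, sat Q & cyl Q x.
  move=> Sx nS'x; pose u := [tuple of mkseq x J'].
  have uF : u \notin F by apply/negP => uF; apply: nS'x.
  have nP : ~ P (finset.setU (finset.set1 u) F).
    move=> /Fmax/(_ (finset.subsetUr _ _))/finset.setP/(_ u); rewrite !inE eqxx/=.
    by move/esym; apply/negP.
  have /negP/asboolPn/existsNP[Q /not_implyP[QJ]] := nP.
  move=> /negP; rewrite -ltNge => big.
  have Qx : cyl Q x.
    apply: contrapT => nQx; move: big; apply/negP; rewrite -leNgt.
    apply: le_trans (PF Q QJ); apply: content_subset => y [[Sy + Qy]].
    rewrite /S0/= !inE => /orP[/eqP E|yF]; last by split.
    exfalso; apply: nQx; apply: cyl_agree Qy; first exact: leq_trans JJ'.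
    by have := congr1 val E.
  exists Q => //; split=> //.
  have H : (pw r (size Q))%:E <= ccont J (S' `&` cyl Q) + (pw r J')%:E.
    apply: (le_trans (ltW big)).
    apply: (@le_trans _ _ (ccont J (S' `&` cyl Q `|` cyl u))).
      apply: content_subset => y [[Sy + Qy]]; rewrite /S0/= !inE => /orP[/eqP E|yF].
        by right; rewrite /cyl/= size_tuple; have := congr1 val E.
      by left.
    apply: (le_trans (content_setU _ _ w0 _ _)); rewrite leeD2l//.
    have := @content1 R _ _ [set w | (J <= size w)%N] cyl _ w0 u (cyl u).
    by rewrite /= size_tuple; apply.
  rewrite -lee_pdivrMl//; rewrite -leeBlDr// in H; apply: le_trans H.
  rewrite -EFinM -EFinB lee_fin.
  have := pw_anti (ltW r0) QJ; have := pw_gt0 r J; nra.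
pose top := [set Q | sat Q /\ forall Q', sat Q' -> cyl Q `<=` cyl Q' -> (size Q <= size Q')%N].
have covertop x : S x -> ~ S' x -> exists2 Q, top Q & cyl Q x.
  move=> Sx nS'x; have [Q0 sQ0 Q0x] := cover x Sx nS'x.
  pose L l := `[< exists Q, [/\ size Q = l, sat Q & cyl Q x] >].
  have exL : exists l, L l by exists (size Q0); apply/asboolP; exists Q0.
  case: (ex_minnP exL) => l /asboolP[Q [Ql sQ Qx]] lmin.
  exists Q => //; split=> // Q' sQ' QQ'; rewrite Ql; apply: lmin.
  by apply/asboolP; exists Q'; split=> //; exact: QQ'.
(* A cover [V] of [S'] by long words becomes one of [S]: the words inside a maximal saturated
   cylinder [Q] are replaced by [Q], which weighs at most [c] times as much as they do together, and
   the others are kept. *)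
have main : ccont 0 S <= c%:E * ccont J S'.
  rewrite -lee_pdivrMl//; apply: le_ereal_inf_tmp => _ [V [VJ VS'] <-].
  rewrite lee_pdivrMl//.
  pose below := [set v | exists2 Q, top Q & cyl v `<=` cyl Q].
  apply: (@le_trans _ _ (\esum_(w in top `|` (V `\` below)) (pw r (size w))%:E)).
    apply: content_le => // x Sx.
    have [[Q tQ Qx]|nQ] := pselect (exists2 Q, top Q & cyl Q x).
      by exists Q => //; left.
    have S'x : S' x by apply: contrapT => /(covertop x Sx).
    have [v Vv vx] := VS' x S'x; exists v => //; right; split=> // -[Q tQ vQ].
    by apply: nQ; exists Q => //; exact: vQ.
  apply: (@le_trans _ _ (\esum_(w in top) (pw r (size w))%:E +
      \esum_(w in V `\` below) (pw r (size w))%:E)).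
    rewrite (esumID top)//; apply: leeD.
      by apply: esum_subset => // w [].
    by apply: esum_subset => // w [[//|]].
  rewrite (esumID below V)// -setDE ge0_muleDr ?esum_ge0//; apply: leeD; last first.
    by rewrite -[leLHS]mul1e; apply: lee_wpmul2r; rewrite ?esum_ge0// lee_fin ltW.
  rewrite -esum_cmul ?(ltW c0)//.
  have /choice[tp Htp] : forall v, exists Q, below v -> top Q /\ cyl v `<=` cyl Q.
    move=> v; have [[Q tQ vQ]|nb] := pselect (below v); first by exists Q.
    by exists v => /nb.
  apply: (@le_trans _ _ (\esum_(Q in top) \esum_(v in V `&` [set v | cyl v `<=` cyl Q])
      (c%:E * (pw r (size v))%:E))).
    apply: le_esum => Q [[QJ sQ] _]; apply: (le_trans sQ).
    rewrite esum_cmul ?(ltW c0)//; apply: lee_wpmul2l; first by rewrite lee_fin ltW.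
    apply: content_le => [v [/VJ//]|x [S'x Qx]].
    have [v Vv vx] := VS' x S'x; exists v => //; split=> //.
    by apply: cyl_nested Qx vx; exact: leq_trans (VJ v Vv).
  have cw0 v : 0 <= c%:E * (pw r (size v))%:E.
    by rewrite -EFinM lee_fin mulr_ge0// ltW.
  rewrite esum_esum//; apply: (esum_le_cover (e := fun v => (tp v, v))) => //.
  move=> [Q v] [/= tQ [Vv vQ]].
  have bv : below v by exists Q.
  exists v => //; congr (_, _).
  have [[st mt] vt] := Htp v bv; have [sQ mQ] := tQ.
  have [d _|noD] := pickP (xpredT : pred D); last first.
    have e0 (w : seq D) : w = [::] by case: w => // d w; have := noD d.
    by rewrite (e0 Q) (e0 (tp v)).
  have vx := cyl_nonempty d v.
  apply: (cyl_eq _ (vt _ vx) (vQ _ vx)).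
  have [le|/ltnW le] := leqP (size (tp v)) (size Q); apply/eqP; rewrite eqn_leq le ?andbT/=.
    by apply: mQ => //; exact: cyl_nested le (vt _ vx) (vQ _ vx).
  by apply: mt => //; exact: cyl_nested le (vQ _ vx) (vt _ vx).
(* A word of length at most [J] can be traded for long words covering its part of [S'], since by
   [PF] the content of that part at depth [J] is at most the weight of the word. *)
have coarse : ccont J S' <= ccont 0 S'.
  apply: le_ereal_inf_tmp => _ [V [_ VS'] <-].
  apply: (@le_trans _ _ (ccont J (\bigcup_(v in V) (S' `&` cyl v)))).
    by apply: content_subset => x S'x; have [v Vv vx] := VS' x S'x; exists v.
  apply: (le_trans (content_bigcup _ _ w0 _ _)); apply: le_esum => v _.
  have [vJ|/ltnW Jv] := leqP (size v) J; first exact: PF.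
  by apply: content1 => // x [].
exists S'; split=> //.
  rewrite -(@lte_pmul2l _ c%:E)// ?lte_fin//.
  apply: (@lt_le_trans _ _ (ccont 0 S)).
    by rewrite mE -EFinM lte_fin ca; lra.
  by apply: (le_trans main); rewrite lee_pmul2l// lte_fin.
exists J' => x y [_ xF] Sy E; split=> //; move: xF; rewrite /S0 /=.
by congr (_ \in F); apply: val_inj.
Qed.

(** [ccont_step] is iterated over all depths and the results are intersected. The content survives
    because [S] is closed and membership in [F n.+1] is decided within [F n] by finitely many
    letters: by Koenig's lemma, cylinders covering the intersection already cover some [F n]. *)
Lemma ccont_subset S (a : R) : (0 < a)%R -> a%:E < ccont 0 S ->
  (forall y, (forall j, exists2 x, S x & mkseq x j = mkseq y j) -> S y) ->
  exists A, [/\ A `<=` S, a%:E <= ccont 0 A & forall J, ccont J A <= 1].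
Proof.
move=> a0 aS cS.
have /choice[g Hg] : forall p : nat * set (nat -> D), exists S', a%:E < ccont 0 p.2 ->
  [/\ S' `<=` p.2, ccont p.1 S' <= 1, a%:E < ccont 0 S' &
    exists J', forall x y, S' x -> p.2 y -> mkseq x J' = mkseq y J' -> S' y].
  move=> [J T] /=; have [aT|] := pselect (a%:E < ccont 0 T); last by exists T.
  by have [S' HS'] := ccont_step J a0 aT; exists S'.
pose F := fix F n := if n is i.+1 then g (i, F i) else S.
have aF n : a%:E < ccont 0 (F n).
  by elim: n => //= n IH; have [] := Hg (n, F n) IH.
have subF n i : (n <= i)%N -> F i `<=` F n.
  elim: i => [|i IH]; first by rewrite leqn0 => /eqP ->.
  rewrite leq_eqVlt ltnS => /predU1P[->//|/IH]; apply: subset_trans.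
  by have [] := Hg (i, F i) (aF i).
exists (\bigcap_n F n); split.
- by move=> x /(_ 0%N I).
- apply: le_ereal_inf_tmp => _ [V [_ VA] <-].
  have [[n VF]|nV] := pselect (exists n, covers cyl V (F n)).
    by apply: (le_trans (ltW (aF n))); apply: content_le.
  have /choice[u Hu] : forall n, exists x, F n x /\ forall v, V v -> ~ cyl v x.
    move=> n; apply: contrapT => /forallNP H; apply: nV; exists n => x Fx.
    by have := H x => /not_andP[//|/existsNP[v /not_implyP[Vv /contrapT vx]]]; exists v.
  have [|y [_ Hy]] := @koenig D (fun=> enum D) u; first by move=> *; rewrite mem_enum.
  have agree j N : exists2 n, (N <= n)%N & mkseq (u n) j = mkseq y j.
    have [n Nn E] := Hy j N; exists n => //; apply/eq_in_map => i.
    by rewrite mem_iota add0n => /andP[_ /E].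
  have Fy n : F n y.
    elim: n => [|n IH].
      by apply: cS => j; have [n _ E] := agree j 0%N; exists (u n) => //;
        apply: (subF 0%N n) => //; have [] := Hu n.
    have [_ _ _ [J' HJ']] := Hg (n, F n) (aF n).
    have [i ni E] := agree J' n.+1.
    by apply: (HJ' (u i)) => //; apply: (subF n.+1 i ni); have [] := Hu i.
  have [v Vv vy] := VA y (fun n _ => Fy n).
  have [n _ E] := agree (size v) 0%N.
  by have [_ /(_ v Vv)] := Hu n; case; rewrite /cyl/= E.
- move=> J; have [_ + _ _] := Hg (J, F J) (aF J); apply: le_trans.
  by apply: content_subset => x /(_ J.+1 I).
Qed.

(* If the cylinders of [V] have total weight less than one, descend through
   children whose part of [V] weighs less than they do: the branch obtained
   meets no cylinder of [V]. *)
Lemma ccont_setT : (#|D|%:R * pw r 1 = 1)%R -> 1 <= ccont 0 [set: nat -> D].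
Proof.
move=> r1; apply: le_ereal_inf_tmp => _ [V [_ VT] <-].
rewrite leNgt; apply/negP => V1.
pose mass w := \esum_(v in V `&` [set v | prefix w v]) (pw r (size v))%:E.
have step w : exists d, mass w < (pw r (size w))%:E ->
    mass (rcons w d) < (pw r (size w).+1)%:E.
  have [lt|] := pselect (mass w < (pw r (size w))%:E); last first.
    have [d _|noD] := pickP (xpredT : pred D); first by exists d.
    by move: r1; rewrite eq_card0// mul0r => /eqP; rewrite eq_sym oner_eq0.
  apply: contrapT => /forallNP H; move: lt; apply/negP; rewrite -leNgt.
  apply: (@le_trans _ _ (\esum_(d in [set: D]) mass (rcons w d))).
    apply: (@le_trans _ _ (\esum_(d in [set: D]) (pw r (size w).+1)%:E)).
      rewrite esum_finT ?sumEFin; last by move=> d; rewrite lee_fin pw_ge0.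
      have <- : (#|D|%:R * pw r (size w).+1 = \sum_(d : D) pw r (size w).+1)%R.
        have E : #|xpredT : pred D| = #|D| by apply: eq_card.
        by rewrite sumr_const mulr_natl -E.
      by rewrite lee_fin -addn1 pwDn mulrCA r1 mulr1.
    apply: le_esum => d _; rewrite leNgt; apply/negP => lt; exact: (H d).
  rewrite esum_esum//; have [d0 _|noD] := pickP (xpredT : pred D); last first.
    rewrite esum1; first exact: esum_ge0.
    by move=> [d v] _; have := noD d.
  apply: (esum_le_cover (e := fun v => (nth d0 v (size w), v))) => //.
  move=> [d v] [_ [Vv /= pv]]; exists v.
    by split=> //=; apply: prefix_trans pv; exact: prefix_rcons.
  congr (_, _); move: pv => /prefixP[s ->].
  by rewrite cat_rcons nth_cat ltnn subnn.
have [g Hg] := choice step.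
pose W := fix W n := if n is i.+1 then rcons (W i) (g (W i)) else [::].
have sW n : size (W n) = n by elim: n => //= n IH; rewrite size_rcons IH.
have mW n : mass (W n) < (pw r n)%:E.
  elim: n => [|n IH] /=.
    rewrite pw0; apply: le_lt_trans V1; apply: esum_subset => // v [].
  by have := Hg (W n); rewrite sW; apply.
pose x i := g (W i).
have xW n : mkseq x n = W n by elim: n => // n IH; rewrite mkseqS IH.
have [v Vv vx] := VT x I.
have := mW (size v); apply/negP; rewrite -leNgt -xW vx.
rewrite -(@esum_set1 _ _ v (fun v => (pw r (size v))%:E))//.
by apply: esum_subset => // _ ->; split=> //=; exact: prefix_refl.
Qed.

End CodeSpace.

(** * Binary addresses of the points of a unit cube *)

Section BinaryCodes.
Context {R : realType} {m : nat} (z : 'rV[int]_m).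
Local Notation D := {ffun 'I_m -> bool}.
Implicit Types (w : seq D) (x y : nat -> D) (p q : 'rV[R]_m).

(** The index, at level [size w], of the subcube of the unit cube at [z] with binary address [w]. *)
Definition wpref w : 'rV[int]_m :=
  foldl (fun (c : 'rV[int]_m) (d : D) => \row_a (2 * c 0 a + (d a : nat)%:Z)) z w.

Lemma wpref_mkseqS x j a : wpref (mkseq x j.+1) 0 a =
  2 * wpref (mkseq x j) 0 a + (x j a : nat)%:Z.
Proof. by rewrite mkseqS /wpref foldl_rcons mxE. Qed.

Lemma wpref_inj v w : size v = size w -> wpref v = wpref w -> v = w.
Proof.
elim/last_ind: v w => [|v d IH] w; first by case: w.
case/lastP: w => [|w e]; first by rewrite size_rcons.
rewrite !size_rcons => -[sE]; rewrite /wpref !foldl_rcons -/(wpref v) -/(wpref w).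
move=> /rowP E.
have E' a : 2 * wpref v 0 a + (d a : nat)%:Z = 2 * wpref w 0 a + (e a : nat)%:Z.
  by have := E a; rewrite !mxE.
have -> : v = w by apply: IH => //; apply/rowP => a; have := E' a; lia.
by congr rcons; apply/ffunP => a; have := E' a; case: (d a); case: (e a) => //=; lia.
Qed.

(* Closed cubes: both binary expansions of a dyadic point are codes of it, which
   makes the set of codes of a closed set closed. *)
Definition codes x p := forall j a,
  (wpref (mkseq x j) 0 a)%:~R <= 2 ^+ j * p 0 a <= (wpref (mkseq x j) 0 a)%:~R + 1.

Let lo x a j : R := (wpref (mkseq x j) 0 a)%:~R / 2 ^+ j.
Let hi x a j : R := ((wpref (mkseq x j) 0 a)%:~R + 1) / 2 ^+ j.

Let lo_hi x a i j : lo x a i <= hi x a j.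
Proof.
have p2 l : 0 < 2 ^+ l :> R by rewrite exprn_gt0.
have loS l : lo x a l <= lo x a l.+1.
  rewrite /lo ler_pdivrMr// mulrAC ler_pdivlMr// exprS wpref_mkseqS intrD intrM.
  by rewrite mulrCA mulrA ler_pM2r// lerDl ler0z.
have hiS l : hi x a l.+1 <= hi x a l.
  rewrite /hi ler_pdivrMr// mulrAC ler_pdivlMr// exprS wpref_mkseqS intrD intrM.
  rewrite [leRHS]mulrCA [leRHS]mulrA ler_pM2r//.
  by case: (x l a) => /=; rewrite ?mulr1z ?mulr0z; lra.
have lohi l : lo x a l <= hi x a l by rewrite /lo /hi ler_pM2r ?invr_gt0// lerDl.
have lom l n : (l <= n)%N -> lo x a l <= lo x a n.
  elim: n => [|n IH]; first by rewrite leqn0 => /eqP ->.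
  by rewrite leq_eqVlt ltnS => /predU1P[->//|/IH/le_trans]; apply.
have him l n : (l <= n)%N -> hi x a n <= hi x a l.
  elim: n => [|n IH]; first by rewrite leqn0 => /eqP ->.
  by rewrite leq_eqVlt ltnS => /predU1P[->//|/IH]; apply: le_trans.
have [ij|/ltnW ji] := leqP i j; first exact: le_trans (lom _ _ ij) (lohi j).
exact: le_trans (lohi i) (him _ _ ji).
Qed.

Lemma codes_exists x : exists p, codes x p.
Proof.
exists (\row_a sup (range (lo x a))) => j a; rewrite mxE.
have p2 : 0 < 2 ^+ j :> R by rewrite exprn_gt0.
rewrite mulrC; apply/andP; split.
  rewrite -ler_pdivrMr//; apply: (@sup_upper_bound _ (range (lo x a))); last by exists j.
  split; first by exists (lo x a 0); exists 0%N.
  by exists (hi x a 0) => _ [i _ <-]; exact: lo_hi.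
rewrite -ler_pdivlMr//; apply: ge_sup; first by exists (lo x a 0); exists 0%N.
by move=> _ [i _ <-]; exact: lo_hi.
Qed.

Definition val_code x : 'rV[R]_m := projT1 (cid (codes_exists x)).

Lemma val_codeP x : codes x (val_code x).
Proof. by rewrite /val_code; case: cid. Qed.

Lemma codes_dist x y p q j : codes x p -> codes y q ->
  mkseq x j = mkseq y j -> forall a, `|p 0 a - q 0 a| <= pw 1 j.
Proof.
move=> xp yq E a; have := xp j a; have := yq j a; rewrite E => hq hp.
have p2 : 0 < 2 ^+ j :> R by rewrite exprn_gt0.
rewrite pw1E -(ler_pM2l p2) mulfV ?gt_eqF//.
rewrite -[X in X * _]gtr0_norm// -normrM mulrBr ler_norml; lra.
Qed.

Lemma codes_inj x p q : codes x p -> codes x q -> p = q.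
Proof.
move=> xp xq; apply/rowP => a; apply/eqP; rewrite -subr_eq0 -normr_eq0.
apply/eqP/le_anti; rewrite normr_ge0 andbT; apply/ler_addgt0Pr => e e0.
have [j je] := @pw_small R 1 e ltr01 e0; rewrite add0r.
exact: le_trans (codes_dist xp xq erefl a) (ltW je).
Qed.

Lemma unitbox_codes p :
  (forall a, (z 0 a)%:~R <= p 0 a <= (z 0 a)%:~R + 1) -> exists x, val_code x = p.
Proof.
move=> bp.
pose dig (c : 'rV[int]_m) j : D :=
  [ffun a => (2 * c 0 a + 1)%:~R <= 2 ^+ j.+1 * p 0 a].
pose g := fix g j := if j is i.+1 then
  \row_a (2 * g i 0 a + (dig (g i) i a : nat)%:Z) else z.
pose x j := dig (g j) j.
have gE j : wpref (mkseq x j) = g j.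
  by elim: j => // j IH; apply/rowP => a; rewrite wpref_mkseqS IH [RHS]mxE.
exists x; apply: codes_inj (val_codeP x) _ => j a; rewrite gE.
elim: j => [|j IH]; first by rewrite expr0 mul1r.
rewrite [g _]/= mxE /dig ffunE.
have -> : 2 ^+ j.+1 * p 0 a = 2 * (2 ^+ j * p 0 a) by rewrite exprS mulrA.
rewrite !intrD !intrM; case: (leP (2 * (g j 0 a)%:~R + 1) (2 * (2 ^+ j * p 0 a))) => /=;
  move: IH; rewrite ?mulr1z ?mulr0z; lra.
Qed.

Local Notation nbs := {ffun 'I_m -> 'I_(1 + 1).+1}.

(** The points coded in a cylinder lie in a closed dyadic cube, which 3^m half-open cubes of the
    same level cover. *)
Lemma dcont_image_cover (s : R) (A : set (nat -> D)) (V : set (seq D)) :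
  covers (@cyl D) V A -> (dcont s (val_code @` A) <=
    (#|nbs|%:R)%:E * \esum_(w in V) (pw s (size w))%:E)%E.
Proof.
move=> VA.
pose g (c : seq D * nbs) : cubeidx m := (size c.1, nbr (wpref c.1) c.2).
apply: le_trans (esum_fibers V (v := fun c : cubeidx m => pw s c.1)
  (g := g) (w := fun w => pw s (size w)) _ _) => [|w|//]; last exact: pw_ge0.
apply: content_le => // _ [x Ax <-]; have [w Vw wx] := VA x Ax.
pose p0 : 'rV[R]_m := \row_a ((wpref w 0 a)%:~R / 2 ^+ size w).
have f0 : fidx (size w) p0 = wpref w.
  by apply/rowP => a; rewrite !mxE mulrC divfK ?expf_neq0// intrKfloor.
have [|ee Hee] := @fidx_nbr R m 1 (size w) p0 (val_code x).
  move=> a; have := val_codeP x (size w) a; rewrite wx => hx.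
  rewrite -[X in X * _]gtr0_norm ?exprn_gt0// -normrM mulrBr mxE.
  rewrite [X in X - _]mulrC divfK ?expf_neq0// ler_norml; lra.
by exists (g (w, ee)); [exists (w, ee)|rewrite /cube/= Hee f0].
Qed.

Lemma dcont_image_val (s r : R) (A : set (nat -> D)) : 0 < r -> r < s ->
  (forall J, (ccont r J A <= 1)%E) -> dcont s (val_code @` A) = 0%E.
Proof.
move=> r0 rs A1; apply/eqP; rewrite eq_le dcont_ge0 andbT.
apply/lee_addgt0Pr => e e0; rewrite add0e.
pose C := #|nbs|%:R : R.
have C0 : 0 < C by rewrite ltr0n card_ffun !card_ord expn_gt0.
have sr0 : 0 < s - r by rewrite subr_gt0.
have [J HJ] := pw_small sr0 (divr_gt0 e0 (mulr_gt0 C0 (ltr0n R 2))).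
have [V [VJ VA V2]] : exists V : set (seq D), [/\ V `<=` [set w | (J <= size w)%N],
    covers (@cyl D) V A & (\esum_(w in V) (pw r (size w))%:E < 2%:E)%E].
  by apply: content_lt; apply: le_lt_trans (A1 J) _; rewrite lte_fin ltr1n.
apply: (le_trans (dcont_image_cover s VA)).
apply: (@le_trans _ _ (C%:E * ((pw (s - r) J)%:E * 2%:E))%E).
  apply: lee_wpmul2l; first by rewrite lee_fin ltW.
  apply: (@le_trans _ _ (\esum_(w in V) ((pw (s - r) J)%:E * (pw r (size w))%:E))%E).
    apply: le_esum => w /VJ Jw; rewrite -EFinM lee_fin.
    have -> : pw s (size w) = pw (s - r) (size w) * pw r (size w) by rewrite -pwD subrK.
    by rewrite ler_wpM2r ?pw_ge0// pw_anti// ltW.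
  rewrite esum_cmul ?pw_ge0//; last by move=> w; rewrite lee_fin pw_ge0.
  by apply: lee_wpmul2l; [rewrite lee_fin pw_ge0|exact: ltW].
rewrite -!EFinM lee_fin mulrCA -ler_pdivlMr ?mulr_gt0//; exact: ltW.
Qed.

Lemma dcont_image0 (s : R) (A : set (nat -> D)) :
  ccont s 0 A = 0%E -> dcont s (val_code @` A) = 0%E.
Proof.
move=> /content_eq0 H; apply/eqP; rewrite eq_le dcont_ge0 andbT.
apply/lee_addgt0Pr => e e0; rewrite add0e.
pose C := #|nbs|%:R : R.
have C0 : 0 < C by rewrite ltr0n card_ffun !card_ord expn_gt0.
have [|V [_ VA Ve]] := H _ (e / C) (divr_gt0 e0 C0); first by move=> w; exact: pw_ge0.
apply: (le_trans (dcont_image_cover s VA)).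
apply: (@le_trans _ _ (C%:E * (e / C)%:E)%E).
  by apply: lee_wpmul2l => //; rewrite lee_fin ltW.
by rewrite -EFinM lee_fin mulrC divfK// gt_eqF.
Qed.

Lemma ccont0_of_image_val (r : R) (A : set (nat -> D)) : 0 < r ->
  dcont r (val_code @` A) = 0%E -> ccont r 0 A = 0%E.
Proof.
move=> r0 /dcont_eq0 H; apply/content_eq0 => [w|e e0]; first exact: pw_ge0.
pose C := #|{ffun 'I_m -> 'I_(1 + 1).+1}|%:R : R.
have C0 : 0 < C by rewrite ltr0n card_ffun !card_ord expn_gt0.
have [U [UA Ue]] := H (e / C) (divr_gt0 e0 C0).
(* On words of one length [wpref] is injective, so neighbouring indices lead back to words; an index
   that belongs to no word gets a dummy word of the right length, which keeps the weights equal. *)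
have /choice[g Hg] : forall c : cubeidx m * {ffun 'I_m -> 'I_(1 + 1).+1},
    exists w : seq D, size w = c.1.1 /\
      ((exists2 v, size v = c.1.1 & wpref v = nbr c.1.2 c.2) -> wpref w = nbr c.1.2 c.2).
  move=> c; have [[v sv pv]|nv] := pselect (exists2 v, size v = c.1.1 & wpref v = nbr c.1.2 c.2).
    by exists v.
  exists (nseq c.1.1 [ffun=> false]); split; first by rewrite size_nseq.
  by move=> /nv.
have key1 (u v : int) : u < v + 1 -> v <= u + 1 ->
  (absz (u - v + 1)%R < (1 + 1).+1)%N by lia.
have key2 (u v : int) : v <= u + 1 -> u = v + (absz (u - v + 1)%R)%:Z - 1 by lia.
exists (g @` (U `*` setT)); split=> //.
  move=> x Ax; have [c Uc cx] := UA (val_code x) (ex_intro2 _ _ x Ax erefl).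
  pose w := mkseq x c.1; have sw : size w = c.1 by rewrite size_mkseq.
  have lt a : (absz (wpref w 0 a - c.2 0 a + 1)%R < (1 + 1).+1)%N.
    have := val_codeP x c.1 a; rewrite -/w => hx.
    move: cx; rewrite /cube/= => /rowP/(_ a); rewrite mxE => fx.
    have := floor_itv (2 ^+ c.1 * val_code x 0 a); rewrite fx intrD => hf.
    have h1 : (wpref w 0 a < c.2 0 a + 1)%R by rewrite -(ltr_int R) intrD; lra.
    have h2 : (c.2 0 a <= wpref w 0 a + 1)%R by rewrite -(ler_int R) intrD; lra.
    exact: key1 h1 h2.
  pose ee : {ffun 'I_m -> 'I_(1 + 1).+1} := [ffun a => Ordinal (lt a)].
  have pe : wpref w = nbr c.2 ee.
    apply/rowP => a; rewrite [RHS]mxE ffunE /=.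
    have := val_codeP x c.1 a; rewrite -/w => hx.
    move: cx; rewrite /cube/= => /rowP/(_ a); rewrite mxE => fx.
    have := floor_itv (2 ^+ c.1 * val_code x 0 a); rewrite fx intrD => hf.
    have h2 : (c.2 0 a <= wpref w 0 a + 1)%R by rewrite -(ler_int R) intrD; lra.
    exact: key2.
  exists (g (c, ee)); first by exists (c, ee).
  have [sg pg] := Hg (c, ee).
  have -> : g (c, ee) = w.
    by apply: wpref_inj; rewrite ?sg ?sw// pg//; exists w.
  by rewrite /cyl/= sw.
apply: le_trans (esum_fibers U (v := fun w => pw r (size w))
  (w := fun c : cubeidx m => pw r c.1) _ _) _ => [c|c f|]; first exact: pw_ge0.
  by have [-> _] := Hg (c, f).
apply: (@le_trans _ _ (C%:E * (e / C)%:E)%E).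
  by apply: lee_wpmul2l => //; rewrite lee_fin ltW.
by rewrite -EFinM lee_fin mulrC divfK// gt_eqF.
Qed.

(* Besicovitch's theorem on subsets of intermediate dimension. *)
Lemma compact_subset_dim (r : R) (K : set 'rV[R]_m) : 0 < r -> compact K ->
  (forall p, K p -> forall a, (z 0 a)%:~R <= p 0 a <= (z 0 a)%:~R + 1) ->
  dcont r K <> 0%E -> exists A, [/\ A `<=` K, dcont r A <> 0%E &
    forall s, r < s -> dcont s A = 0%E].
Proof.
move=> r0 cK Kz K0; pose S := [set x : nat -> D | K (val_code x)].
have SK : val_code @` S = K.
  apply/seteqP; split=> [_ [x Sx <-]//|p Kp].
  by have [x xp] := unitbox_codes (Kz p Kp); exists x; rewrite /S/= xp.
have S0 : ccont r 0 S <> 0%E by move=> /dcont_image0; rewrite SK.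
have [a a0 aS] : exists2 a : R, 0 < a & (a%:E < ccont r 0 S)%E.
  move: S0 (ccont_ge0 r 0 S) (ccont_le1 r S); case: (ccont r 0 S) => [c| |]//.
  move=> c0; rewrite lee_fin => c1 _; have cp : 0 < c.
    by rewrite lt_neqAle c1 andbT; apply/eqP => c0'; apply: c0; rewrite -c0'.
  by exists (c / 2); rewrite ?divr_gt0// lte_fin; lra.
have cS y : (forall j, exists2 x, S x & mkseq x j = mkseq y j) -> S y.
  move=> H; rewrite /S/=.
  have clK : closed K := compact_closed (@norm_hausdorff _ _) cK.
  apply: clK => B /nbhs_ballP[e /= e0 eB].
  have [j je] := @pw_small R 1 e ltr01 e0.
  have [x Sx E] := H j; exists (val_code x); split=> //; apply: eB.
  split=> // i a'; rewrite ord1.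
  exact: le_lt_trans (codes_dist (val_codeP y) (val_codeP x) (esym E) a') je.
have [A [AS aA A1]] := ccont_subset r0 a0 aS cS.
exists (val_code @` A); split.
- by rewrite -SK; exact: image_subset.
- move=> /(ccont0_of_image_val r0) A0; move: aA; rewrite A0 lee_fin; lra.
- by move=> s rs; exact: dcont_image_val r0 rs A1.
Qed.

End BinaryCodes.

(** For the exponent [m] the weights of the 2^m children of a word add up to its own, so
    [ccont_setT] applies to binary addresses. *)
Lemma dcont_setT_neq0 (R : realType) (m : nat) : (0 < m)%N ->
  dcont m%:R [set: 'rV[R]_m] <> 0%E.
Proof.
move=> m0 T0; have mR : 0 < m%:R :> R by rewrite ltr0n.
have := @ccont0_of_image_val R m 0 m%:R setT mR (dcont_null_subset _ T0).
move=> /(_ (fun _ _ => I)).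
have := @ccont_setT R {ffun 'I_m -> bool} m%:R _.
rewrite card_ffun card_bool card_ord natrX pw_nat expr1 divff ?expf_neq0//.
by move=> /(_ erefl) + E; rewrite E lee_fin ler10.
Qed.

(** * Unions of affine subspaces *)

Section AffineGraphs.
Context {R : realType} {k n : nat}.
Implicit Types (P : set 'rV[R]_(k + n)).

(** Non-verticality makes the projection of [V] to R^k surjective, and equality of dimensions makes
    it injective. The preimages [v b] of the basis vectors then express differences of points
    through their projections and give the Lipschitz constant. *)
Lemma affine_graph P : (0 < k)%N -> affine_grassmannian R (k + n) k P ->
  nonvertical P -> (exists M, lipgraph M P) /\ @lsubmx R 1 k n @` P = setT.
Proof.
move=> k0 [a [V [dV PE]]] nv.
have surjP t : exists2 x, P x & lsubmx x = t.
  have : [set row_mx t (0 : 'rV[R]_n) | t in [set: 'rV[R]_k]] (row_mx t 0) by exists t.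
  rewrite -nv => -[x Px /(congr1 lsubmx)]; rewrite /proj_horizontal !row_mxKl => E.
  by exists x.
have surjV t : exists2 v, v \in V & lsubmx v = t.
  have [x Px xt] := surjP (t + lsubmx a); exists (x - a); first by rewrite PE in Px.
  by rewrite linearB /= xt addrK.
pose f : 'Hom('rV[R]_(k + n), 'rV[R]_k) := linfun (@lsubmx R 1 k n).
have fE x : f x = lsubmx x by rewrite lfunE.
have fV : (f @: V)%VS = fullv.
  apply/vspaceP => t; rewrite memvf; have [v vV <-] := surjV t.
  by rewrite -fE memv_img.
have V0 v : v \in V -> lsubmx v = 0 -> v = 0.
  move=> vV lv; have := limg_ker_dim f V.
  rewrite fV dimvf dim_matrix mul1r dV -[RHS]add0n => /addIn/eqP.
  rewrite dimv_eq0 => /eqP K0; apply/eqP; rewrite -memv0 -K0 memv_cap vV.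
  by rewrite memv_ker fE lv eqxx.
split; last by apply/seteqP; split=> // t _; have [x Px xt] := surjP t; exists x.
have /choice[v Hv] : forall b : 'I_k, exists v, v \in V /\ lsubmx v = delta_mx 0 b.
  by move=> b; have [v vV lv] := surjV (delta_mx 0 b); exists v.
pose M := Num.bound (\sum_(b < k) \sum_(c < k + n) `|v b 0 c|).
exists M => x y d Px Py dxy c.
have d0 : 0 <= d by apply: le_trans (normr_ge0 _) (dxy (Ordinal k0)).
have dV' : x - y \in V.
  rewrite PE /= in Px; rewrite PE /= in Py.
  have -> : x - y = (x - a) - (y - a) by rewrite opprB addrA subrK.
  exact: memvB.
pose u := lsubmx (x - y).
have E : x - y = \sum_(b < k) u 0 b *: v b.
  apply/eqP; rewrite -subr_eq0; apply/eqP; apply: V0.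
    rewrite memvB// memv_suml// => b _; apply: memvZ; by have [] := Hv b.
  rewrite linearB linear_sum /= -/u [X in X - _](row_sum_delta u).
  apply/eqP; rewrite subr_eq0; apply/eqP; apply: eq_bigr => b _.
  by rewrite linearZ /= (Hv b).2.
have -> : x 0 c - y 0 c = (x - y) 0 c by rewrite !mxE.
rewrite E summxE; apply: (le_trans (ler_norm_sum _ _ _)).
apply: (@le_trans _ _ (\sum_(b < k) d * `|v b 0 c|)).
  apply: ler_sum => b _; rewrite mxE normrM ler_wpM2r//.
  by have := dxy b; rewrite /u linearB /= !mxE.
rewrite -mulr_sumr mulrC ler_wpM2r//.
apply: le_trans (ltW (archi_boundP _)); last first.
  by apply: sumr_ge0 => b _; apply: sumr_ge0.
by apply: ler_sum => b _; rewrite (bigD1 c)//= lerDl sumr_ge0.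
Qed.

End AffineGraphs.

(** * Hausdorff dimension through dyadic null sets *)

Section Dimension.
Context {R : realType}.
Implicit Types (m : nat) (s r d : R).

Lemma dcont_null_le m s r (A : set 'rV[R]_m) : s <= r -> dcont s A = 0%E -> dcont r A = 0%E.
Proof.
move=> sr /dcont_eq0 H; apply/dcont_eq0 => e /H[U [UA Ue]]; exists U; split=> //.
by apply: le_trans Ue; apply: le_esum => c _; rewrite lee_fin pw_antis.
Qed.

(** The definition of the dimension admits the exponent 0, which the comparison with [dcont]
    excludes. There each nonempty set of a cover contributes 1. *)
Lemma hausdorff0_set0 m (A : set 'rV[R]_m) : hausdorff_measure 0 A = 0%E -> A = set0.
Proof.
move=> H0; have : (hausdorff_pre 0 1 A < 1)%E.
  apply: (@le_lt_trans _ _ 0%E); last by rewrite lte_fin.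
  by rewrite -H0; apply: ereal_sup_ubound; exists 1 => /=.
move=> /ereal_inf_lt[_ [U [UA _ ->]] U1].
apply/seteqP; split=> // x /UA[i _ Ux].
move: U1; apply/negP; rewrite -leNgt.
rewrite nneseries_esumT; last by move=> j; exact: diam_pow_ge0.
apply: (@le_trans _ _ (diam_pow 0 (U i))).
  rewrite /diam_pow ifF ?poweRe0//; apply/negP => /eqP Ui.
  by rewrite Ui in Ux.
rewrite -(@esum_set1 _ _ i (fun i => diam_pow 0 (U i)))//; last exact: diam_pow_ge0.
by apply: esum_subset => // j; exact: diam_pow_ge0.
Qed.

Lemma hausdorff0_dcont_lt m s r (A : set 'rV[R]_m) : 0 <= s -> s < r ->
  hausdorff_measure s A = 0%E -> dcont r A = 0%E.
Proof.
rewrite le_eqVlt => /predU1P[<- r0 /hausdorff0_set0 ->|s0 sr H].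
  by apply/dcont_eq0 => e e0; exists set0; split=> //; rewrite esum_set0 lee_fin ltW.
exact: dcont_null_le (ltW sr) (hausdorff0_dcont0 s0 H).
Qed.

Lemma hausdorff_dim_le m d (A : set 'rV[R]_m) : 0 <= d ->
  (forall s, d < s -> dcont s A = 0%E) -> (hausdorff_dim A <= d%:E)%E.
Proof.
move=> d0 H; apply/lee_addgt0Pr => e e0; apply: ereal_inf_lbound.
exists (d + e) => //; split; first by rewrite addr_ge0// ltW.
by apply: dcont0_hausdorff0; [rewrite ltr_wpDl|apply: H; rewrite ltrDl].
Qed.

Lemma hausdorff_dim_ge m r (A : set 'rV[R]_m) :
  dcont r A <> 0%E -> (r%:E <= hausdorff_dim A)%E.
Proof.
move=> A0; apply: le_ereal_inf_tmp => _ [s [s0 Hs] <-].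
rewrite lee_fin leNgt; apply/negP => sr.
exact: A0 (hausdorff0_dcont_lt s0 sr Hs).
Qed.

Lemma hausdorff_dim_gt m r (A : set 'rV[R]_m) : 0 < r ->
  (r%:E < hausdorff_dim A)%E -> dcont r A <> 0%E.
Proof.
move=> r0 + A0; apply/negP; rewrite -leNgt; apply: ereal_inf_lbound.
by exists r => //; split; [exact: ltW|exact: dcont0_hausdorff0].
Qed.

Lemma hausdorff_dim_lt m s (A : set 'rV[R]_m) :
  (hausdorff_dim A < s%:E)%E -> dcont s A = 0%E.
Proof.
move=> /ereal_inf_lt[_ [r [r0 Hr] <-]]; rewrite lte_fin => rs.
exact: hausdorff0_dcont_lt Hr.
Qed.

End Dimension.

(** * Capacity of B on either side of the essential supremum *)

Section EssentialSupremum.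
Context {R : realType} {k n : nat} (B : set 'rV[R]_(k + n)).
Hypotheses (hk : (0 < k)%N) (hB : borel_set B).
Local Open Scope ereal_scope.
Local Notation beta := (ess_sup_slice_dim B).

Let big_slices (q : R) := [set t : 'rV[R]_k | q%:E < hausdorff_dim (slice B t)].

Let kR : (0 < k%:R :> R)%R. Proof. by rewrite ltr0n. Qed.

Let big_slicesP q : 0 < hausdorff_measure k%:R (big_slices q) <->
  dcont k%:R (big_slices q) <> 0.
Proof.
rewrite lt_neqAle hausdorff_measure_ge0 andbT; split=> [/eqP H H0|H].
  by apply: H; rewrite dcont0_hausdorff0.
by apply/eqP => /esym /(hausdorff0_dcont0 kR).
Qed.

Lemma ess_sup_ge0 : 0 <= beta.
Proof. by apply: ereal_sup_ubound; left. Qed.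

(** If [cap s B] were positive, so would be that of some compact [K] inside [B]; but for [q] between
    [beta] and [s] the slices of [K] are null for the exponent [s] outside the null set
    [big_slices q]. *)
Lemma cap_gt_ess_sup (s : R) : beta < s%:E -> cap s B = 0.
Proof.
move=> bs; have [q [q0 bq qs]] : exists q : R, [/\ (0 <= q)%R, beta < q%:E & (q < s)%R].
  have fb : beta \is a fin_num.
    by rewrite ge0_fin_numE ?ess_sup_ge0//; apply: lt_trans bs _; rewrite ltry.
  have := ess_sup_ge0; move: bs; rewrite -(fineK fb) !lee_fin !lte_fin => h1 h2.
  by exists ((fine beta + s) / 2)%R; rewrite lte_fin; split; lra.
have Nq : dcont k%:R (big_slices q) = 0.
  apply: contrapT => /big_slicesP H; move: bq; apply/negP; rewrite -leNgt.
  by apply: ereal_sup_ubound; right; exists q.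
apply: contrapT => /(cap_borel_compact hB)[z [K [cK KB Kz]]]; apply.
apply: (cap_compact0 cK Kz Nq) => t nN.
apply: (@dcont_null_subset _ _ _ _ (slice B t)); first by move=> y /KB.
apply: hausdorff_dim_lt; apply: (@le_lt_trans _ _ q%:E); last by rewrite lte_fin.
by rewrite leNgt; apply/negP.
Qed.

Lemma cap_lt_ess_sup (q : R) : (0 < q)%R ->
  0 < hausdorff_measure k%:R (big_slices q) -> cap q B <> 0.
Proof.
move=> q0 /big_slicesP H /cap0_slice[N N0 HN]; apply: H.
apply: dcont_null_subset N0 => t Bt; apply: contrapT => /HN.
exact: hausdorff_dim_gt.
Qed.

Lemma graph_full_subset : exists L, (forall s : R, beta < s%:E -> dcont (k%:R + s)%R L = 0) /\
  forall M P, lipgraph M P -> P `<=` B ->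
    dcont k%:R (@lsubmx R 1 k n @` (P `\` L)) = 0.
Proof.
have [boo|fb] := eqVneq beta +oo.
  exists setT; split=> [s|M P _ _]; first by rewrite boo ltNge leey.
  rewrite (_ : _ @` _ = set0); first exact: (outer_measure0 (@lam_outer R k)).
  by apply/seteqP; split=> // _ [x [_ []]].
have {}fb : beta \is a fin_num by rewrite ge0_fin_numE ?ess_sup_ge0// ltey.
pose b := fine beta; have bE : beta = b%:E by rewrite fineK.
have b0 : (0 <= b)%R by rewrite -lee_fin -bE ess_sup_ge0.
pose e i : R := (i.+1%:R^-1)%R.
have e0 i : (0 < e i)%R by rewrite invr_gt0.
have /choice[L HL] : forall i, exists L, dcont (k%:R + (b + e i) + e i + e i)%R L = 0 /\
    forall M P, lipgraph M P -> P `<=` B ->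
      dcont k%:R (@lsubmx R 1 k n @` (P `\` L)) = 0.
  move=> i; apply: density_cover => //; first by rewrite ltr_wpDl.
  by apply: cap_gt_ess_sup; rewrite bE lte_fin ltrDl.
exists (\bigcap_i L i); split=> [s|M P PM PB].
  rewrite bE lte_fin => bs.
  (* The null exponent of [L i] exceeds [k + b] by three times [e i]: once to get above [beta],
     twice through [density_cover]. *)
  have sb : (0 < (s - b) / 3)%R by rewrite divr_gt0 ?subr_gt0.
  have [i _ /(_ i (leqnn i)) /= Hi] := near_infty_natSinv_lt (PosNum sb).
  have [Li _] := HL i.
  apply: (@dcont_null_subset _ _ _ _ (L i)); first by move=> x; apply.
  apply: dcont_null_le Li; have {Hi} : (e i < (s - b) / 3)%R by exact: Hi.
  move: (e i) => ei; lra.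
apply: (@dcont_null_subset _ _ _ _ (\bigcup_(i in [set: nat]) @lsubmx R 1 k n @` (P `\` L i))).
  move=> _ [x [Px /existsNP[i /not_implyP[_ nL]]] <-].
  by exists i => //; exists x.
by apply: dcont_bigcup0 => i _; have [_ H] := HL i; exact: H PM PB.
Qed.

(** Rational exponents keep the union countable. Each compact set is cut down to dimension exactly
    [k + ratr c], so that the union stays null for exponents above [k + beta]. *)
Lemma slice_dim_subset : exists A, [/\ A `<=` B,
  forall s : R, beta < s%:E -> dcont (k%:R + s)%R A = 0 &
  forall q r : R, (0 < r)%R -> (r < q)%R ->
    0 < hausdorff_measure k%:R (big_slices q) ->
    exists2 s : R, (r < s)%R & dcont (k%:R + s)%R A <> 0].
Proof.
have /choice[A HA] : forall c : rat, exists A, [/\ A `<=` B,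
    forall s : R, beta < s%:E -> dcont (k%:R + s)%R A = 0 &
    (0 < ratr c :> R)%R -> 0 < hausdorff_measure k%:R (big_slices (ratr c)) ->
      dcont (k%:R + ratr c)%R A <> 0].
  move=> c; have [[c0 Hc]|nc] := pselect ((0 < ratr c :> R)%R /\
      0 < hausdorff_measure k%:R (big_slices (ratr c))); last first.
    exists set0; split=> // [s _|c0 Hc]; last by exfalso; apply: nc.
    by apply/dcont_eq0 => e e0; exists set0; split=> //; rewrite esum_set0 lee_fin ltW.
  have [z [K [cK KB Kz K0]]] := cap_borel_compact hB (cap_lt_ess_sup c0 Hc).
  have {}K0 : dcont (k%:R + ratr c)%R K <> 0 by move/dcont0_cap0.
  have [A [AK A0 As]] := compact_subset_dim (addr_gt0 kR c0) cK Kz K0.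
  exists A; split=> //; first exact: subset_trans KB.
  move=> s bs; apply: As; rewrite ltrD2l -lte_fin; apply: le_lt_trans bs.
  by apply: ereal_sup_ubound; right; exists (ratr c) => //; split=> //; exact: ltW.
exists (\bigcup_(c in [set: rat]) A c); split.
- by move=> x [c _]; have [+ _ _] := HA c; apply.
- by move=> s bs; apply: dcont_bigcup0 => c _; have [_ + _] := HA c; apply.
- move=> q r r0 rq Hq; have [c] := rat_in_itvoo rq; rewrite in_itv/= => /andP[rc cq].
  exists (ratr c) => //; have [_ _ Hc] := HA c.
  move=> A0; apply: Hc; [exact: lt_trans rc| |].
    apply/big_slicesP => N0; move/big_slicesP: Hq; apply.
    apply: dcont_null_subset N0 => t; apply: lt_trans; by rewrite lte_fin.
  by apply: dcont_null_subset A0 => x; exists c.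
Qed.

End EssentialSupremum.

(* The ambient dimension is m = k + n, i.e. n = m - k > 0. *)
Theorem corollary3p2 (R : realType) (k n : nat) (hk : (0 < k)%N) (hn : (0 < n)%N)
    (E : set (set 'rV[R]_(k + n)))
    (hE0 : E !=set0)
    (hE : E `<=` affine_grassmannian R (k + n) k)
    (hnv : forall P, E P -> nonvertical P)
    (hB : borel_set (\bigcup_(P in E) P)) :
  exists P' : set 'rV[R]_(k + n) -> set 'rV[R]_(k + n),
    (forall P, E P ->
       P' P `<=` P /\ hausdorff_measure k%:R (P `\` P' P) = 0%E) /\
    hausdorff_dim (\bigcup_(P in E) P' P) =
      (ess_sup_slice_dim (\bigcup_(P in E) P) + k%:R%:E)%E.
Proof.
set B := \bigcup_(P in E) P; set beta := ess_sup_slice_dim B.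
have kR : 0 < k%:R :> R by rewrite ltr0n.
have [L [Ls LP]] := graph_full_subset hk hB.
have [A [AB As Aq]] := slice_dim_subset hk hB.
have null P : E P -> dcont k%:R (P `\` (L `|` A)) = 0%E.
  move=> EP; have [[M PM] _] := affine_graph hk (hE _ EP) (hnv _ EP).
  apply: (@dcont_null_subset _ _ _ _ (P `\` L)).
    by move=> x [Px nLA]; split=> // Lx; apply: nLA; left.
  apply: (lipgraph_null PM) => [x []//|]; apply: LP PM _.
  by move=> x Px; exists P.
exists (fun P => P `&` (L `|` A)); split=> [P EP|].
  split; first by move=> x [].
  by rewrite setDIr setDv set0U; apply: dcont0_hausdorff0 => //; exact: null.
set B' := \bigcup_(P in E) _.
have AB' : A `<=` B' by move=> x Ax; have [P EP Px] := AB x Ax; exists P => //; split=> //; right.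
(* This gives the lower bound [k], which settles small [q]: some plane lies in [B'] up to a null set
   and projects onto R^k. *)
have B'0 : dcont k%:R B' <> 0%E.
  move=> B'0; have [P EP] := hE0.
  have [_ PT] := affine_graph hk (hE _ EP) (hnv _ EP).
  apply: (@dcont_setT_neq0 R k hk); rewrite -PT; apply: lsubmx_null.
  apply: (@dcont_null_subset _ _ _ _ (B' `|` P `\` (L `|` A))).
    move=> x Px; have [LAx|] := pselect ((L `|` A) x); last by right.
    by left; exists P.
  exact: dcont_nullU (null P EP).
apply/eqP; rewrite eq_le; apply/andP; split.
  have b0 : (0 <= beta)%E := ess_sup_ge0 B.
  have [->|boo] := eqVneq beta +oo%E; first by rewrite addye// leey.
  have fb : beta \is a fin_num by rewrite ge0_fin_numE// ltey.
  rewrite -(fineK fb) -EFinD; apply: hausdorff_dim_le.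
    by rewrite addr_ge0// fine_ge0.
  move=> s bs; have {}bs : (beta < (s - k%:R)%:E)%E.
    by rewrite -(fineK fb) lte_fin ltrBrDr.
  apply: (@dcont_null_subset _ _ _ _ (L `|` A)); first by move=> x [P _ []].
  by rewrite -(subrK k%:R s) addrC; apply: dcont_nullU; [exact: Ls|exact: As].
have kB' : (k%:R%:E <= hausdorff_dim B')%E := hausdorff_dim_ge B'0.
rewrite -leeBrDr//; apply: ge_ereal_sup => _ [->|[q [q0 Hq] <-]]; rewrite leeBrDr//.
  by rewrite add0e.
(* [Aq] asks for a positive exponent below [q]; [q - e] is one unless [q <= e], where dimension at
   least [k] is enough. *)
apply/lee_addgt0Pr => e e0; have [qe|eq] := leP q e.
  rewrite addeC; apply: leeD => //; by rewrite lee_fin.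
have [r0 rq] : 0 < q - e /\ q - e < q by split; lra.
have [s rs sA] := Aq q (q - e) r0 rq Hq.
have : ((k%:R + s)%:E <= hausdorff_dim B')%E.
  by apply: hausdorff_dim_ge => B'0s; apply: sA; exact: dcont_null_subset B'0s.
move=> /(leeD2r e%:E); apply: le_trans.
by rewrite -!EFinD lee_fin; lra.
Qed.
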